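(* Let $a,b,c\in\mathbb{R}$ with $c\neq 0$, $a\neq b/|c|$ and $\ln|c|\neq -\frac12(a+b/|c|)$. Let $\mathcal{E}(\beta_m,\alpha_m;K_m)$, $m\in\mathbb{N}$, denote all the (countably infinitely many) exponential dichotomies of the scalar neutral equation $$x'(t)+c\,x'(t-1)+a\,x(t)+b\,x(t-1)=0,\qquad x\in\mathbb{R},$$ and let $P_m^{+}$ and $P_m^{-}$, $m\in\mathbb{N}$, denote the corresponding unstable and stable dichotomy projections. Then: (i) the operator norms of $P_m^{\pm}:C[-1,0]\to C[-1,0]$ satisfy $\sup_{m\in\mathbb{N}}\|P_m^{+}\|=+\infty$ and $\sup_{m\in\mathbb{N}}\|P_m^{-}\|=+\infty$; (ii) the sequential dichotomies of the equation are not uniform, i.e. $\sup_{m\in\mathbb{N}}K_m=+\infty$.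
   Context: $C[-1,0]$ is the Banach space of continuous real functions on $[-1,0]$ with the supremum norm $\|\cdot\|_\infty$. For each $\phi\in C[-1,0]$ the neutral equation has a unique solution $x(t,\phi)$, $t\ge -1$, with $x(\theta,\phi)=\phi(\theta)$ for $\theta\in[-1,0]$. The solution is understood in the usual sense of neutral functional differential equations: $x$ is continuous on $[-1,\infty)$, $t\mapsto x(t)+c\,x(t-1)$ is continuously differentiable on $[0,\infty)$, and $\frac{d}{dt}[x(t)+c\,x(t-1)]=-a\,x(t)-b\,x(t-1)$ for $t\ge 0$. The solution operators $T(t)\phi=x_t(\cdot,\phi)$, with $x_t(\theta,\phi)=x(t+\theta,\phi)$ for $\theta\in[-1,0]$, $t\geq 0$, form a strongly continuous semigroup $\{T(t):t\ge0\}$ on $C[-1,0]$. A $C^0$ semigroup $\{T(t):t\ge 0\}$ on a Banach space admits an exponential dichotomy (on $[0,+\infty)$) if there exist (bounded linear) projections $\Pi_-$ and $\Pi_+:=I-\Pi_-$ on the space, and real constants $\alpha>\beta$ and $K\ge 1$, such that: (D1) $T(t)\Pi_\pm=\Pi_\pm T(t)$ for $t\ge 0$; (D2) for $t\ge0$, $T(t)|_{\mathcal{R}(\Pi_+)}$ is an isomorphism of the range $\mathcal{R}(\Pi_+)$ onto itself, whose inverse is denoted $T(-t):\mathcal{R}(\Pi_+)\to\mathcal{R}(\Pi_+)$; (D3) $\|T(t)\Pi_-\|\le Ke^{\beta t}$ and $\|T(-t)\Pi_+\|\le Ke^{-\alpha t}$ for $t\ge 0$. Such a dichotomy is denoted $\mathcal{E}(\beta,\alpha;K)$;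 $K$ is its bound, $\Pi_+$ its unstable projection and $\Pi_-$ its stable projection. The equation is said to admit an exponential dichotomy if its solution semigroup $\{T(t)\}$ on $C[-1,0]$ does. Counting convention: two exponential dichotomies are regarded as the same if they have the same pair of projections; thus the list $\mathcal{E}(\beta_m,\alpha_m;K_m)$, $m\in\mathbb{N}$, contains every pair of dichotomy projections exactly once, each with some admissible choice of exponents $\beta_m<\alpha_m$ and bound $K_m$. Under the stated hypotheses on $a,b,c$ there are countably infinitely many dichotomies. The sequence of dichotomies is called (sequentially) uniform if $\sup_m K_m<+\infty$. *)

(* Defs.v *)
From HB Require Import structures.
From mathcomp Require Import all_boot all_order all_algebra.
From mathcomp Require Import all_classical all_reals all_analysis.

Set Implicit Arguments.
Unset Strict Implicit.
Unset Printing Implicit Defensive.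
Import Order.TTheory GRing.Theory Num.Theory.
Import numFieldNormedType.Exports.

Local Open Scope classical_set_scope.
Local Open Scope ring_scope.

Definition delay (R : realType) : set R := `[-1, 0].
Arguments delay R : clear implicits.

Section C10_space.
Variable R : realType.

(* [delay R] used as a type carries the subspace topology of R. *)
Definition cont10 : {pred (delay R -> R)} :=
  fun f => `[< continuous f >].

Record C10 : Type := MkC10 {
  C10_fun :> delay R -> R ;
  _ : C10_fun \in cont10 }.

HB.instance Definition _ := [isSub for C10_fun].
HB.instance Definition _ := gen_eqMixin C10.
HB.instance Definition _ := gen_choiceMixin C10.

Lemma C10_continuous (f : C10) : continuous f.
Proof. by case: f => f /= /asboolP. Qed.

Lemma C10_ext (f g : C10) : f =1 g -> f = g.
Proof. by move=> /funext fg; exact: val_inj. Qed.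

Lemma cont10_submod_closed : submod_closed cont10.
Proof.
split; first exact/asboolP/(@cst_continuous (delay R) R 0).
move=> k f g /asboolP cf /asboolP cg; apply/asboolP => x.
exact: (@cvgD _ R^o _ _ _ (k \*: f) g _ _ (cvgZr (V := R^o) (cf x)) (cg x)).
Qed.

HB.instance Definition _ :=
  GRing.isSubmodClosed.Build _ _ cont10 cont10_submod_closed.
HB.instance Definition _ := [SubChoice_isSubLmodule of C10 by <:].

Definition supnorm (f : C10) : R := sup (range (fun u => `|f u|)).

Lemma delay0P : (0 : R) \in delay R.
Proof. by rewrite inE /delay /= in_itv /= lexx andbT lerN10. Qed.

Definition delay0 : delay R := exist _ 0 delay0P.

Lemma supnorm_ub (f : C10) : has_ubound (range (fun u => `|f u|)).
Proof.
have cf : {within delay R, continuous (valL_ 0 (f : delay R -> R))}.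
  by apply/subspace_valL_continuousP'; exact: C10_continuous.
have [|||c _ cP] := @compact_EVT_max _ _
    (fun x => `|valL_ 0 (f : delay R -> R) x|) (delay R).
- by exists 0; exact/set_mem/delay0P.
- exact: segment_compact.
- by move=> x; apply: cvg_norm; exact: cf.
exists `|valL_ 0 (f : delay R -> R) c| => _ [u _ <-].
have := cP (set_val u) (valP u).
by have -> : valL_ 0 (f : delay R -> R) (set_val u) = f u
  by have := congr1 (@^~ u) (valLK 0 (f : delay R -> R)).
Qed.

Lemma le_supnorm (f : C10) u : `|f u| <= supnorm f.
Proof. by apply: ub_le_sup; [exact: supnorm_ub | exists u]. Qed.

Lemma supnorm_le (f : C10) M : (forall u, `|f u| <= M) -> supnorm f <= M.
Proof.
move=> fM; apply: ge_sup; first by exists `|f delay0|, delay0.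
by move=> _ [u _ <-].
Qed.

Lemma supnormD (f g : C10) : supnorm (f + g) <= supnorm f + supnorm g.
Proof.
apply: supnorm_le => u.
by rewrite (le_trans (ler_normD (f u) (g u)))// lerD// le_supnorm.
Qed.

Lemma supnormZ (k : R) (f : C10) : supnorm (k *: f) = `|k| * supnorm f.
Proof.
have leZ l (h : C10) : supnorm (l *: h) <= `|l| * supnorm h.
  apply: supnorm_le => u.
  by rewrite [_ u]/(l * h u) normrM ler_wpM2l// le_supnorm.
apply/eqP; rewrite eq_le leZ /=.
have [->|k0] := eqVneq k 0.
  by rewrite normr0 mul0r (le_trans _ (le_supnorm _ delay0)).
rewrite -ler_pdivlMl ?normr_gt0// -normfV.
by rewrite (le_trans _ (leZ _ _))// scalerA mulVf// scale1r.
Qed.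

Lemma supnorm0_eq0 (f : C10) : supnorm f = 0 -> f = 0.
Proof.
move=> f0; apply: C10_ext => u; apply/eqP.
by rewrite -normr_le0 -f0 le_supnorm.
Qed.

HB.instance Definition _ :=
  Lmodule_isNormed.Build R C10 supnormD supnormZ supnorm0_eq0.

End C10_space.

Section dichotomy.
Variables (R : realType) (V : normedModType R).

Definition opnorm (A : V -> V) : \bar R :=
  ereal_sup [set `|A x|%:E | x in [set x | `|x| <= 1]].

Definition bounded_projection (P : V -> V) : Prop :=
  [/\ linear P, bounded_fun_norm P & P \o P = P].

(* [f] restricts to an isomorphism (linear homeomorphism) of the subspace [E]
   onto itself, with inverse the restriction of [g]. *)
Definition isomorphism_on (E : set V) (f g : V -> V) : Prop :=
  [/\ (forall k x y, E x -> E y -> f (k *: x + y) = k *: f x + f y),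
      (forall x, E x -> E (f x) /\ g (f x) = x),
      (forall x, E x -> E (g x) /\ f (g x) = x),
      (exists M, forall x, E x -> `|f x| <= M * `|x|) &
      (exists M, forall x, E x -> `|g x| <= M * `|x|)].

(* [T t] matters only for [0 <= t]; [Tinv t] is the operator T(-t) on the range
   of [Pp]. *)
Definition exp_dichotomy (T : R -> V -> V) (Pp Pm : V -> V)
    (beta alpha K : R) : Prop :=
  [/\ [/\ bounded_projection Pm, bounded_projection Pp &
          Pp = (fun x => x - Pm x)],
      [/\ beta < alpha & 1 <= K],
      forall t, 0 <= t -> T t \o Pm = Pm \o T t /\ T t \o Pp = Pp \o T t &
      exists Tinv : R -> V -> V, forall t, 0 <= t ->
        [/\ isomorphism_on (range Pp) (T t) (Tinv t),
            (opnorm (T t \o Pm) <= (K * expR (beta * t))%:E)%E &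
            (opnorm (Tinv t \o Pp) <= (K * expR (- alpha * t))%:E)%E]].

(* The dichotomies of [T], two of them being identified when they have the same
   projections, are listed exactly once each. *)
Definition lists_dichotomies (T : R -> V -> V) (Pp Pm : nat -> V -> V)
    (beta alpha K : nat -> R) : Prop :=
  (forall m, exp_dichotomy T (Pp m) (Pm m) (beta m) (alpha m) (K m)) /\
  (forall Qp Qm b a k, exp_dichotomy T Qp Qm b a k ->
     exists! m, Pp m = Qp /\ Pm m = Qm).

End dichotomy.

Section neutral_equation.
Variable R : realType.

(* The restriction of [h] makes the derivative one-sided at 0. *)
Definition C1_halfline (f f' : R -> R) : Prop :=
  {within `[0, +oo[, continuous f'} /\
  forall t, 0 <= t ->
    h^-1 * (f (t + h) - f t) @[h --> within [set h | 0 <= t + h] 0^'] --> f' t.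

(* x'(t) + c x'(t-1) + a x(t) + b x(t-1) = 0 with initial value [phi], in the
   sense of neutral equations: x itself need not be differentiable. Only the
   values of [x] on [-1, +oo[ matter. *)
Definition neutral_solution (a b c : R) (phi : C10 R) (x : R -> R) : Prop :=
  [/\ {within `[-1, +oo[, continuous x},
      forall theta : delay R, x (\val theta) = phi theta &
      C1_halfline (fun t => x t + c * x (t - 1))
                  (fun t => - a * x t - b * x (t - 1))].

(* The segment x_t of the solution with initial value [phi]. That solution exists
   and is unique on [-1, +oo[, so for [0 <= t] the set below is a singleton. *)
Definition solution_operator (a b c t : R) (phi : C10 R) : C10 R :=
  get [set psi : C10 R | exists2 x, neutral_solution a b c phi x &
    forall theta : delay R, psi theta = x (t + \val theta)].

End neutral_equation.

(* Main.v *)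
Require Import Defs.
From mathcomp Require Import all_boot all_order all_algebra.
From mathcomp Require Import all_classical all_reals all_analysis.
From mathcomp Require Import complex.
From mathcomp Require Import ring lra.
Import Order.TTheory GRing.Theory Num.Theory.
Import numFieldNormedType.Exports.

(** Because [c] does not vanish, every initial value extends to a unique solution on
    the whole line, and the equation reversed in time has the same form. A dichotomy
    sorts these solutions by their growth: one that is [O(exp (r t))] at [-oo] with
    [r > beta] is unstable, one that is [O(exp (r t))] at [+oo] with [r < alpha] is
    stable ([splits_unstable], [splits_stable]). Hence dichotomies whose open gaps
    from [beta] to [alpha] overlap coincide ([splits_overlap]). Let [sigma = ln |c|].
    At most one gap contains [sigma], so infinitely many gaps lie on one side of it,
    and by reversal of time on its right. Suppose that all the projections are
    bounded by [M].

    Between two gaps on the right of [sigma] there is the real part of a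
    characteristic exponent ([root_between]). Indeed the operator
    [x |-> x t + c x (t - 1)] can be inverted backwards on functions of order
    [exp (alpha t)] with [alpha > sigma], which yields a uniform Lipschitz estimate for
    the solutions whose growth lies between the gaps; such solutions form a
    finite-dimensional space, in which [d/dt] has an eigenvector.

    The bound [M] keeps exponents that are separated by a gap at a positive distance
    from one another ([separated_roots]). As there are infinitely many gaps, the
    imaginary parts of these exponents are unbounded ([right_roots_unbounded]). Now
    comparing moduli in [exp lambda = - (c lambda + b) / (lambda + a)] puts the exponents
    [mu + i w] on a curve on which [mu] tends to [sigma] as [w] grows. So the gaps
    accumulate at [sigma], the constant [kappa] that governs the curve near [sigma] is
    positive ([kappa_gt0]), the curve is there the graph of a decreasing function, and
    it carries an exponent near [sigma + i freq n] for every large [n]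
    ([roots_exist]), where the [freq n] have spacing [2 pi].

    The unstable projection of a gap close to [sigma] therefore acts on these modes
    as the truncation of a Fourier series at some large [N]. Truncations are not
    uniformly bounded in the supremum norm: the Fejer-weighted sum of
    [(cos ((N - k) x) - cos ((N + k) x)) / k] is bounded ([fejer_sawtooth_le]), its part
    with frequencies below [N] takes the value of a harmonic sum at 0. Since the modes
    are only required to be close to exponentials, with a fixed small error, this
    contradicts [M] ([right_gaps_absurd]).

    Stable and unstable projections add up to the identity, and [T 0] is the
    identity, so that a bound for the stable projections or for the constants [K m]
    bounds the unstable projections. *)

Set Implicit Arguments.
Unset Strict Implicit.
Unset Printing Implicit Defensive.

Local Open Scope classical_set_scope.
Local Open Scope ring_scope.

(** * Derivatives and primitives *)

Section calculus.
Variable R : realType.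
Implicit Types (f g : R -> R) (k s t u v a b : R).

Lemma drvD f g t a b : is_derive t 1 f a -> is_derive t 1 g b ->
  is_derive t 1 (fun s => f s + g s) (a + b).
Proof. by move=> fa gb; exact: is_deriveD. Qed.

Lemma drvB f g t a b : is_derive t 1 f a -> is_derive t 1 g b ->
  is_derive t 1 (fun s => f s - g s) (a - b).
Proof. by move=> fa gb; exact: is_deriveB. Qed.

Lemma drvM f g t a b : is_derive t 1 f a -> is_derive t 1 g b ->
  is_derive t 1 (fun s => f s * g s) (a * g t + f t * b).
Proof.
move=> fa gb; apply: (is_derive_eq (is_deriveM fa gb)).
by rewrite addrC /GRing.scale /= [g t * a]mulrC.
Qed.

Lemma drv_cst k t : is_derive t 1 (fun _ : R => k) 0.
Proof. exact: is_derive_cst. Qed.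

Lemma drvZ k f t a : is_derive t 1 f a -> is_derive t 1 (fun s => k * f s) (k * a).
Proof. by move=> fa; exact: is_deriveZ. Qed.

Lemma drv_comp f g t a b : is_derive (g t) 1 f a -> is_derive t 1 g b ->
  is_derive t 1 (fun s => f (g s)) (a * b).
Proof. by move=> fa gb; exact: (@is_derive1_comp _ f g). Qed.

Lemma drv_id t : is_derive t 1 (fun s : R => s) 1.
Proof. exact: is_derive_id. Qed.

Lemma drv_shift f t k a : is_derive (t + k) 1 f a ->
  is_derive t 1 (fun s => f (s + k)) a.
Proof.
move=> fa; have d : is_derive t 1 (fun s => s + k) 1.
  by have := drvD (drv_id t) (drv_cst k t); rewrite addr0.
by have := drv_comp (g := fun s => s + k) fa d; rewrite mulr1.
Qed.

Lemma drv_refl f k t a : is_derive (k - t) 1 f a ->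
  is_derive t 1 (fun s => f (k - s)) (- a).
Proof.
move=> fa; have d : is_derive t 1 (fun s => k - s) (-1).
  by have := drvB (drv_cst k t) (drv_id t); rewrite sub0r.
by have := drv_comp (g := fun s => k - s) fa d; rewrite mulrN1.
Qed.

Lemma drv_val f t a b : is_derive t 1 f a -> a = b -> is_derive t 1 f b.
Proof. by move=> ? <-. Qed.

Lemma drv_expl k t : is_derive t 1 (fun s => expR (k * s)) (k * expR (k * t)).
Proof.
have := drv_comp (g := fun s => k * s) (is_derive_expR (k * t)) (drvZ k (drv_id t)).
by rewrite mulr1 mulrC.
Qed.

Lemma drv_cosl k t : is_derive t 1 (fun s => cos (k * s)) (- k * sin (k * t)).
Proof.
have := drv_comp (g := fun s => k * s) (is_derive_cos (k * t)) (drvZ k (drv_id t)).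
by rewrite mulr1 mulNr mulrC -mulNr.
Qed.

Lemma drv_sinl k t : is_derive t 1 (fun s => sin (k * s)) (k * cos (k * t)).
Proof.
have := drv_comp (g := fun s => k * s) (is_derive_sin (k * t)) (drvZ k (drv_id t)).
by rewrite mulr1 mulrC.
Qed.

Lemma drv_cont f t a : is_derive t 1 f a -> {for t, continuous f}.
Proof.
by move=> fa; apply: differentiable_continuous; exact/derivable1_diffP.
Qed.

Lemma drv_uniq f t a b : is_derive t 1 f a -> is_derive t 1 f b -> a = b.
Proof. by move=> fa fb; rewrite -(@derive_val _ _ _ _ _ _ _ fa) derive_val. Qed.

Lemma mean_value_bound f (df : R -> R) u v m : u <= v -> continuous f ->
  (forall t, u < t < v -> is_derive t 1 f (df t)) ->
  (forall t, u <= t <= v -> `|df t| <= m) -> `|f v - f u| <= m * (v - u).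
Proof.
move=> uv cf dfE dfm.
have dfE' t : t \in `]u, v[ -> is_derive t 1 f (df t).
  by rewrite in_itv/= => /dfE.
have [t tuv ->] := MVT_segment uv dfE' (continuous_subspaceT cf).
rewrite normrM [`|v - u|]ger0_norm ?subr_ge0//.
by rewrite ler_wpM2r ?subr_ge0// dfm//; move: tuv; rewrite in_itv/=.
Qed.

Lemma derive_zero_eq f u v : u <= v -> continuous f ->
  (forall t, u < t < v -> is_derive t 1 f 0) -> f v = f u.
Proof.
move=> uv cf df; apply/eqP; rewrite -subr_eq0 -normr_le0.
rewrite (le_trans (mean_value_bound (m := 0) uv cf df _))// ?mul0r// => t _.
by rewrite normr0.
Qed.

(** The integrals with left end [k] give a primitive on the half-line to the
    right of [k]. Two of them differ by a constant, so that those with [k = - n],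
    normalised at 0, fit together on the whole line. *)
Lemma primitive_exists f : continuous f ->
  exists F : R -> R, F 0 = 0 /\ forall t, is_derive t 1 F (f t).
Proof.
move=> cf.
pose I (k t : R) := (\int[@lebesgue_measure R]_(s in `[k, t]) f s)%R.
have dI k t : k < t -> is_derive t 1 (I k) (f t).
  move=> kt; have [] := @continuous_FTC1_closed _ f k t (t + 1) _ _ _ (cf t).
  - by rewrite ltrDl.
  - by apply: continuous_compact_integrable;
      [exact: segment_compact|exact: continuous_subspaceT].
  - exact: kt.
  by move=> dI E; rewrite -E derive1E; apply: derivableP.
pose A (k t : R) := I k t - I k 0.
have dA k t : k < t -> is_derive t 1 (A k) (f t).
  by move=> kt; apply: drv_val (drvB (dI _ _ kt) (drv_cst _ _)) _; rewrite subr0.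
have AE k l t : k < 0 -> l < 0 -> k < t -> l < t -> A k t = A l t.
  move=> k0 l0 kt lt; apply/eqP; rewrite -subr_eq0; apply/eqP.
  pose D s := A k s - A l s; rewrite -[LHS]/(D t).
  have D0 : D 0 = 0 by rewrite /D /A !subrr.
  have dD s : Num.max k l < s -> is_derive s 1 D 0.
    rewrite gt_max => /andP[ks ls].
    by apply: drv_val (drvB (dA _ _ ks) (dA _ _ ls)) _; rewrite subrr.
  have Dcst u v : Num.max k l < u -> u <= v -> D u = D v.
    move=> ku uv; have [||c _] := @MVT_segment _ D (cst 0) u v uv.
    - by move=> s; rewrite in_itv/= => /andP[us _]; apply/dD/(lt_trans ku).
    - apply: derivable_within_continuous => s; rewrite in_itv/= => /andP[us _].
      by have [] := dD s (lt_le_trans ku us).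
    by rewrite mul0r => /eqP; rewrite subr_eq0 => /eqP.
  have [t0|/ltW t0] := leP 0 t.
    by rewrite -(Dcst 0 t)// gt_max k0.
  by rewrite (Dcst t 0)// gt_max kt.
pose n t : R := - (Num.truncn `|t|).+1%:R.
have nlt t : n t < t /\ n t < 0.
  rewrite /n oppr_lt0 ltr0n; split=> //.
  by rewrite ltrNl (le_lt_trans (ler_norm _))// normrN truncnS_gt.
exists (fun t => A (n t) t); split; first by rewrite /A subrr.
move=> t; have [nt nt0] := nlt t.
apply: near_eq_is_derive (dA _ _ nt).
near=> s; have [ns ns0] := nlt s; apply: AE => //.
by near: s; apply: lt_nbhsr.
Unshelve. all: by end_near. Qed.

Definition prim f : R -> R :=
  get [set F : R -> R | F 0 = 0 /\ forall t, is_derive t 1 F (f t)].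

Lemma prim0 f : continuous f -> prim f 0 = 0.
Proof. by move=> /primitive_exists /getPex []. Qed.

Lemma drv_prim f t : continuous f -> is_derive t 1 (prim f) (f t).
Proof. by move=> /primitive_exists /getPex []. Qed.

Lemma prim_continuous f : continuous f -> continuous (prim f).
Proof. by move=> cf t; exact: drv_cont (drv_prim t cf). Qed.

Lemma primD f s t : continuous f ->
  is_derive t 1 (fun t => prim f (t + s)) (f (t + s)).
Proof. by move=> cf; apply: drv_shift; exact: drv_prim. Qed.

Lemma eq_prim f g t : continuous f -> continuous g -> 0 <= t ->
  (forall s, 0 <= s <= t -> f s = g s) -> prim f t = prim g t.
Proof.
move=> cf cg t0 fg; apply/eqP; rewrite -subr_eq0; apply/eqP.
have cD : continuous (fun s => prim f s - prim g s).
  by move=> s; apply: cvgB; exact: prim_continuous.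
have dD s : 0 < s < t -> is_derive s 1 (fun s => prim f s - prim g s) 0.
  move=> /andP[s0 st]; apply: drv_val (drvB (drv_prim s cf) (drv_prim s cg)) _.
  by rewrite fg ?subrr// !ltW.
by have := derive_zero_eq t0 cD dD; rewrite !prim0// subrr.
Qed.

End calculus.

(** * The equation solved forwards in time *)

Section continuity.
Variable R : realType.
Implicit Types (f g : R -> R) (k t : R).

Lemma ctsD f g : continuous f -> continuous g -> continuous (fun t => f t + g t).
Proof. by move=> cf cg t; apply: cvgD; [exact: cf|exact: cg]. Qed.

Lemma ctsB f g : continuous f -> continuous g -> continuous (fun t => f t - g t).
Proof. by move=> cf cg t; apply: cvgB; [exact: cf|exact: cg]. Qed.

Lemma ctsM f g : continuous f -> continuous g -> continuous (fun t => f t * g t).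
Proof. by move=> cf cg t; apply: cvgM; [exact: cf|exact: cg]. Qed.

Lemma cts_cst k : continuous (fun _ : R => k).
Proof. by move=> t; exact: cvg_cst. Qed.

Lemma cts_id : continuous (fun t : R => t).
Proof. by move=> t; exact: cvg_id. Qed.

Lemma cts_comp f g : continuous f -> continuous g -> continuous (fun t => f (g t)).
Proof. by move=> cf cg t; exact: (continuous_comp (cg t) (cf (g t))). Qed.

Lemma ctsZ k f : continuous f -> continuous (fun t => k * f t).
Proof. by move=> cf; apply: ctsM => //; exact: cts_cst. Qed.

Lemma cts_shift f k : continuous f -> continuous (fun t => f (t + k)).
Proof.
by move=> cf; apply: cts_comp => //; exact: ctsD cts_id (@cts_cst k).
Qed.

Lemma cts_refl f k : continuous f -> continuous (fun t => f (k - t)).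
Proof.
by move=> cf; apply: cts_comp => //; exact: ctsB (@cts_cst k) cts_id.
Qed.

Lemma cts_expl k : continuous (fun t => expR (k * t)).
Proof. by move=> t; exact: drv_cont (drv_expl k t). Qed.

Lemma cts_min k : continuous (fun t => Num.min t k).
Proof. by move=> t; apply: continuous_min; [exact: cvg_id|exact: cvg_cst]. Qed.

Lemma cts_max k : continuous (fun t => Num.max t k).
Proof. by move=> t; apply: continuous_max; [exact: cvg_id|exact: cvg_cst]. Qed.

(** The constant corrects [g] so that the result is continuous whatever the two
    values at [k] are. *)
Definition paste k f g t := f (Num.min t k) + (g (Num.max t k) - g k).

Lemma paste_continuous k f g : continuous f -> continuous g ->
  continuous (paste k f g).
Proof.
move=> cf cg; apply: ctsD; first exact: cts_comp cf (@cts_min k).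
by apply: ctsB (@cts_cst _); exact: cts_comp cg (@cts_max k).
Qed.

Lemma paste_le k f g t : t <= k -> paste k f g t = f t.
Proof. by move=> tk; rewrite /paste min_l// max_r// subrr addr0. Qed.

Lemma paste_ge k f g t : f k = g k -> k <= t -> paste k f g t = g t.
Proof. by move=> fg kt; rewrite /paste min_r// max_l// fg addrC subrK. Qed.

End continuity.

Section equation.
Variable R : realType.
Implicit Types (a b c s t : R) (x z d phi : R -> R).

(** Since [c] does not vanish the equation can be solved in both directions of
    time, so that its solutions may be taken on the whole line. *)
Definition full_sol a b c x :=
  continuous x /\
  forall t, is_derive t 1 (fun s => x s + c * x (s - 1))
                          (- a * x t - b * x (t - 1)).

(** By steps of length one: where the delayed terms vanish, the integrated equation
    says that the primitive of [d] is a multiple of [exp (- a t)]. *)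
Lemma vanishing_forward a b c d : continuous d ->
  (forall t, -1 <= t <= 0 -> d t = 0) ->
  (forall t, 0 < t -> is_derive t 1 (fun s => d s + c * d (s - 1))
                                    (- a * d t - b * d (t - 1))) ->
  forall t, 0 <= t -> d t = 0.
Proof.
move=> cd d0 dd.
pose U := prim d.
have U0 t : -1 <= t <= 0 -> U t = 0.
  move=> /andP[t1 t0].
  rewrite -(prim0 cd); symmetry; apply: derive_zero_eq t0 (prim_continuous cd) _.
  move=> s /andP[ts s0]; apply: drv_val (drv_prim s cd) _.
  by rewrite d0// (le_trans t1) ltW.
pose E t := (d t + c * d (t - 1)) + (a * U t + b * U (t + (-1))).
have E0 t : 0 <= t -> E t = 0.
  move=> t0; have -> : E t = E 0.
    apply: derive_zero_eq t0 _ _.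
      apply: ctsD; apply: ctsD => //.
      - by apply: ctsZ; exact: cts_shift.
      - by apply: ctsZ; exact: prim_continuous.
      - by apply: ctsZ; apply: cts_shift; exact: prim_continuous.
    move=> s /andP[s0 st].
    apply: drv_val (drvD (dd _ s0) (drvD (drvZ a (drv_prim s cd))
      (drvZ b (primD (-1) s cd)))) _.
    by ring.
  by rewrite /E !d0 ?U0; lra.
suff H (n : nat) t : -1 <= t <= n%:R -> d t = 0 /\ U t = 0.
  move=> t t0; have /andP[_ tn] := truncn_itv t0.
  by have [] := H (Num.truncn t).+1 t; first by apply/andP; split; lra.
elim: n t => [|n IH] t /andP[t1 tn]; first by rewrite d0 ?U0// t1.
have [tn'|/ltW nt] := leP t n%:R; first by apply: IH; rewrite t1.
have n0 : 0 <= n%:R :> R by [].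
move: tn; rewrite -natr1 => tn.
have eqU s : n%:R <= s <= t -> d s + a * U s = 0.
  move=> /andP[ns st]; have := E0 s (le_trans n0 ns).
  have [ds Us] : d (s - 1) = 0 /\ U (s - 1) = 0.
    by apply: IH; apply/andP; split; lra.
  by rewrite /E ds Us; lra.
have UE : U t = 0.
  pose V s := expR (a * s) * U s.
  suff : V t = 0 by move/eqP; rewrite mulf_eq0 gt_eqF ?expR_gt0//= => /eqP.
  have -> : V t = V n%:R.
    apply: derive_zero_eq nt _ _.
      by apply: ctsM; [exact: cts_expl|exact: prim_continuous].
    move=> s /andP[ns st].
    apply: drv_val (drvM (drv_expl a s) (drv_prim s cd)) _.
    have ds : d s = - (a * U s) by apply/eqP; rewrite -addr_eq0 eqU ?ltW.
    by rewrite ds -/U; ring.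
  have [|_ Un] := IH n%:R; first by apply/andP; split; lra.
  by rewrite /V Un mulr0.
by split=> //; rewrite -(eqU t) ?nt ?lexx// UE mulr0 addr0.
Qed.

Section forward_existence.
Variables (a b c : R) (phi : R -> R).
Hypothesis cphi : continuous phi.

Let F x t := phi 0 + c * phi (-1) - c * x (t + (-1))
             - b * prim (fun s => x (s + (-1))) t.
Let U x t := expR (- a * t) * prim (fun s => expR (a * s) * F x s) t.

(** On each interval of length one the equation, integrated, is a linear
    differential equation for the primitive [U] of the solution, with a right
    member [F] that involves the preceding interval only. *)
Let step x := paste 0 phi (fun t => F x t - a * U x t).

Let F_continuous x : continuous x -> continuous (F x).
Proof.
move=> cx; have cs := cts_shift (k := -1) cx.
apply: ctsB; last by apply: ctsZ; exact: prim_continuous.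
by apply: ctsB; [exact: cts_cst|exact: ctsZ].
Qed.

Let eF_continuous x : continuous x -> continuous (fun s => expR (a * s) * F x s).
Proof. by move=> cx; apply: ctsM; [exact: cts_expl|exact: F_continuous]. Qed.

Let U_continuous x : continuous x -> continuous (U x).
Proof.
move=> cx; apply: ctsM; first exact: cts_expl.
by apply: prim_continuous; exact: eF_continuous.
Qed.

Let drv_U x t : continuous x -> is_derive t 1 (U x) (F x t - a * U x t).
Proof.
move=> cx.
apply: drv_val (drvM (drv_expl (- a) t) (drv_prim t (eF_continuous cx))) _.
rewrite -[F x t in RHS]mul1r -(expR0 R).
have -> : expR 0 = expR (- a * t) * expR (a * t) :> R.
  by rewrite -expRD; congr expR; ring.
by rewrite /U; ring.
Qed.

Let step_continuous x : continuous x -> continuous (step x).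
Proof.
move=> cx; apply: paste_continuous => //; apply: ctsB; first exact: F_continuous.
by apply: ctsZ; exact: U_continuous.
Qed.

Let step_neg x t : t <= 0 -> step x t = phi t.
Proof. exact: paste_le. Qed.

Let step_pos x t : continuous x -> x (-1) = phi (-1) -> 0 <= t ->
  step x t = F x t - a * U x t.
Proof.
move=> cx x1 t0; apply: paste_ge => //.
rewrite /F /U !prim0; [|exact: eF_continuous|exact: cts_shift].
by rewrite add0r x1; ring.
Qed.

Let eq_F x z t : continuous x -> continuous z -> 0 <= t ->
  (forall s, s <= t - 1 -> x s = z s) -> F x t = F z t.
Proof.
move=> cx cz t0 xz; rewrite /F xz//.
congr (_ - b * _); apply: eq_prim => // [||s /andP[s0 st]]; first exact: cts_shift.
  exact: cts_shift.
by apply: xz; lra.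
Qed.

Let eq_step x z t : continuous x -> continuous z ->
  (forall s, s <= t -> x s = z s) ->
  forall s, s <= t + 1 -> step x s = step z s.
Proof.
move=> cx cz xz s st.
have [s0|/ltW s0] := leP s 0; first by rewrite !step_neg.
have eF r : 0 <= r <= s -> F x r = F z r.
  by move=> /andP[r0 rs]; apply: eq_F => // q qr; apply: xz; lra.
have eU r : 0 <= r <= s -> U x r = U z r.
  move=> /andP[r0 rs]; rewrite /U; congr (_ * _).
  apply: eq_prim => // [||q /andP[q0 qr]]; try exact: eF_continuous.
  by rewrite eF// q0 (le_trans qr).
rewrite /step /paste max_l// !eF ?eU ?lexx ?s0//.
Qed.

Let iterate n := iter n step phi.

Let iterate_continuous n : continuous (iterate n).
Proof. by elim: n => [//|n IH]; exact: step_continuous. Qed.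

Let iterateS n t : t <= n%:R -> iterate n t = iterate n.+1 t.
Proof.
elim: n t => [|n IH] t; first by move=> t0; rewrite [RHS]step_neg.
rewrite -natr1.
exact: (eq_step (@iterate_continuous n) (@iterate_continuous n.+1) IH).
Qed.

Let iterate_stable n m t : t <= n%:R -> iterate n t = iterate (n + m) t.
Proof.
move=> tn; elim: m => [|m ->]; first by rewrite addn0.
rewrite addnS -iterateS// (le_trans tn)// ler_nat leq_addr//.
Qed.

(** The [n]-th iterate of [step] is exact up to time [n], and no longer changes
    there; [x] is the limit of these stationary iterates. *)
Lemma forward_solution_exists : exists x : R -> R,
  [/\ continuous x, forall t, t <= 0 -> x t = phi t &
      forall t, 0 <= t ->
        x t + c * x (t - 1) = phi 0 + c * phi (-1)
          + prim (fun s => - a * x s - b * x (s - 1)) t].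
Proof.
pose N t := (Num.truncn `|t|).+1.
have ltN t : t < (N t)%:R by rewrite (le_lt_trans (ler_norm t))// truncnS_gt.
pose x t := iterate (N t) t.
have xE n t : t <= n%:R -> x t = iterate n t.
  move=> tn; have [le|le] := leqP n (N t).
    by rewrite /x -(subnKC le) -iterate_stable.
  by rewrite -(subnKC (ltnW le)) -iterate_stable// ltW.
have cx : continuous x.
  move=> t; apply: (@cvg_trans _ (iterate (N t) @ t)); last first.
    have -> : x t = iterate (N t) t by rewrite (xE (N t)) ?ltW.
    exact: iterate_continuous.
  apply: near_eq_cvg; near=> s; rewrite (xE (N t))//; apply/ltW.
  by near: s; exact: lt_nbhsl.
have xneg t : t <= 0 -> x t = phi t by move=> t0; rewrite (xE 0%N).
have x1 : x (-1) = phi (-1) by rewrite xneg//; lra.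
have xstep t : 0 <= t -> x t = F x t - a * U x t.
  move=> t0; rewrite -step_pos// (xE (N t).+1); last first.
    by rewrite ltW// (lt_trans (ltN t))// ltr_nat.
  rewrite [LHS]/(step (iterate (N t)) t).
  apply: (eq_step (t := t) (@iterate_continuous (N t)) cx); last by rewrite lerDl.
  by move=> s st; rewrite (xE (N t))// (le_trans st)// ltW.
exists x; split=> // t t0.
have cg : continuous (fun s => - a * x s - b * x (s - 1)).
  by apply: ctsB; apply: ctsZ => //; exact: cts_shift.
pose P s := prim (fun s => - a * x s - b * x (s - 1)) s
  + (a * U x s + b * prim (fun s => x (s + (-1))) s).
have cs := cts_shift (k := -1) cx.
have : P t = P 0.
  apply: derive_zero_eq t0 _ _.
    apply: ctsD; first exact: prim_continuous.
    by apply: ctsD; apply: ctsZ; [exact: U_continuous|exact: prim_continuous].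
  move=> s /andP[s0 st].
  apply: drv_val (drvD (drv_prim s cg) (drvD (drvZ a (drv_U s cx))
    (drvZ b (drv_prim s cs)))) _.
  by rewrite -xstep ?ltW//; ring.
rewrite {2}/P /U !prim0//; last exact: eF_continuous.
by rewrite xstep// /P /F /U; lra.
Unshelve. all: by end_near. Qed.

End forward_existence.

End equation.

(** * Solutions on the whole line and their flow *)

Section full_solutions.
Variable R : realType.
Implicit Types (a b c s t k : R) (x z d phi : R -> R).

(** The reflection of time in the midpoint of the interval [[-1, 0]] keeps that
    interval and exchanges [x t] and [x (t - 1)]; dividing by [c] restores the form
    of the equation. *)
Lemma full_sol_rev a b c x : c != 0 -> full_sol a b c x ->
  full_sol (- (b / c)) (- (a / c)) c^-1 (fun t => x (-1 - t)).
Proof.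
move=> c0 [cx dx]; split; first exact: cts_refl.
move=> t.
have -> : (fun s => x (-1 - s) + c^-1 * x (-1 - (s - 1))) =
    (fun s => c^-1 * ((fun r => x r + c * x (r - 1)) (0 - s))).
  apply/funext => s; rewrite mulrDr mulrA mulVf// mul1r addrC.
  by congr (c^-1 * x _ + x _); ring.
apply: drv_val (drvZ c^-1 (drv_refl (dx (0 - t)))) _.
have -> : 0 - t = -1 - (t - 1) by ring.
have -> : -1 - (t - 1) - 1 = -1 - t by ring.
by ring.
Qed.

Lemma full_sol_lin a b c k x z : full_sol a b c x -> full_sol a b c z ->
  full_sol a b c (fun t => k * x t + z t).
Proof.
move=> [cx dx] [cz dz]; split; first by apply: ctsD => //; exact: ctsZ.
move=> t.
have -> : (fun s => k * x s + z s + c * (k * x (s - 1) + z (s - 1))) =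
   (fun s => k * (x s + c * x (s - 1)) + (z s + c * z (s - 1))).
  by apply/funext => s; ring.
by apply: drv_val (drvD (drvZ k (dx t)) (dz t)) _; ring.
Qed.

Lemma full_sol_shift a b c x s : full_sol a b c x ->
  full_sol a b c (fun t => x (t + s)).
Proof.
move=> [cx dx]; split; first exact: cts_shift.
move=> t.
have -> : (fun r => x (r + s) + c * x (r - 1 + s)) =
   (fun r => (fun q => x q + c * x (q - 1)) (r + s)).
  by apply/funext => r; rewrite addrAC.
by apply: drv_val (drv_shift (dx (t + s))) _; rewrite addrAC.
Qed.

Lemma full_sol_uniq a b c x z : c != 0 -> full_sol a b c x -> full_sol a b c z ->
  (forall t, -1 <= t <= 0 -> x t = z t) -> x = z.
Proof.
move=> c0 fx fz xz.
pose d t := (-1) * x t + z t.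
have fd : full_sol a b c d by exact: full_sol_lin.
have d0 t : -1 <= t <= 0 -> d t = 0 by move=> t0; rewrite /d xz//; ring.
suff H t : d t = 0 by apply/funext => t; have := H t; rewrite /d; lra.
have [t0|/ltW t0] := leP 0 t.
  have [cd dd] := fd; exact: (vanishing_forward cd d0 (fun s _ => dd s) t0).
have [t1|/ltW t1] := leP (-1) t; first by rewrite d0// t1.
have [cd' dd'] := full_sol_rev c0 fd.
have -> : t = -1 - (-1 - t) by ring.
apply: (vanishing_forward cd' _ (fun s _ => dd' s)); last by lra.
by move=> s /andP[s1 s0]; apply: d0; apply/andP; split; lra.
Qed.

(** The solution for positive times and the one of the reversed equation, reflected
    back, agree on [[-1, 0]]. The integrated equation holds on both sides of 0, which
    gives the two-sided derivative there. *)
Lemma full_sol_exists a b c phi : c != 0 -> continuous phi ->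
  exists2 x, full_sol a b c x & forall t, -1 <= t <= 0 -> x t = phi t.
Proof.
move=> c0 cphi.
have [x1 [cx1 x1phi x1E]] := forward_solution_exists a b c cphi.
have [x2 [cx2 x2phi x2E]] := forward_solution_exists (- (b / c)) (- (a / c)) c^-1
  (cts_refl (k := -1) cphi).
pose x := paste (-1) (fun t => x2 (-1 - t)) x1.
have xE1 t : -1 <= t -> x t = x1 t.
  by move=> t1; apply: paste_ge => //; rewrite subrr x2phi// x1phi ?subr0//; lra.
have xE2 t : t <= 0 -> x t = x2 (-1 - t).
  move=> t0; have [t1|/ltW t1] := leP t (-1); first exact: paste_le.
  rewrite xE1// x1phi// x2phi; last by lra.
  by congr phi; ring.
have cx : continuous x by apply: paste_continuous => //; exact: cts_refl.
have x0 t : -1 <= t <= 0 -> x t = phi t.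
  by move=> /andP[t1 t0]; rewrite xE1// x1phi.
exists x => //; split=> //.
have cg : continuous (fun s => - a * x s - b * x (s - 1)).
  by apply: ctsB; apply: ctsZ => //; exact: cts_shift.
suff yE t : x t + c * x (t - 1) = phi 0 + c * phi (-1)
    + prim (fun s => - a * x s - b * x (s - 1)) t.
  move=> t; rewrite (funext yE).
  by apply: drv_val (drvD (drv_cst _ _) (drv_prim t cg)) _; rewrite add0r.
have [t0|/ltW t0] := leP 0 t.
  rewrite !xE1; [|lra|lra]; rewrite x1E//; congr (_ + _).
  apply: eq_prim => // [|s /andP[s0 st]].
    by apply: ctsB; apply: ctsZ => //; exact: cts_shift.
  by rewrite !xE1//; lra.
have nt0 : 0 <= - t by lra.
have := x2E _ nt0.
set g2 := (fun s => _).
have -> : x2 (- t) = x (t - 1).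
  by rewrite xE2; [congr x2; ring|lra].
have -> : x2 (- t - 1) = x t.
  by rewrite xE2; [congr x2; ring|lra].
rewrite subr0 subrr => E.
have -> : x t + c * x (t - 1) = c * (x (t - 1) + c^-1 * x t).
  by field.
rewrite E mulrDr mulrDr mulrA divff// mul1r [c * _ + phi 0]addrC; congr (_ + _).
have cg2 : continuous g2.
  by apply: ctsB; apply: ctsZ => //; exact: cts_shift.
apply/eqP; rewrite -subr_eq0; apply/eqP.
pose D s := c * prim g2 s - prim (fun s => - a * x s - b * x (s - 1)) (0 - s).
have D0 : D 0 = 0 by rewrite /D subr0 !prim0// mulr0 subrr.
have : D (- t) = D 0.
  apply: derive_zero_eq nt0 _ _.
    apply: ctsB; first by apply: ctsZ; exact: prim_continuous.
    by apply: cts_refl; exact: prim_continuous.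
  move=> s /andP[s0 st].
  apply: drv_val (drvB (drvZ c (drv_prim s cg2)) (drv_refl (drv_prim (0 - s) cg))) _.
  rewrite /g2 xE2; last by lra.
  rewrite xE2; last by lra.
  have -> : -1 - (0 - s) = s - 1 by ring.
  have -> : -1 - (0 - s - 1) = s by ring.
  by field.
by rewrite D0 /D sub0r opprK.
Qed.

End full_solutions.

Section flow.
Variable R : realType.
Implicit Types (a b c s t k : R) (x z : R -> R) (phi psi : C10 R)
  (theta : delay R).

Lemma within_continuous_comp (A : set R) x z : {within A, continuous x} ->
  continuous z -> (forall t, A (z t)) -> continuous (fun t => x (z t)).
Proof.
move=> /subspace_continuousP cx cz Az t.
move=> P /(cx _ (Az t)) HP.
have C : \forall s \near t, A (z s) -> P (x (z s)) := cz t _ HP.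
rewrite -[nbhs _ P]/(\forall s \near t, P (x (z s))).
by apply: (filterS _ C) => s; apply.
Qed.

Lemma delay_itv theta : -1 <= \val theta <= 0.
Proof. by have := set_mem (valP theta); rewrite /delay /= in_itv. Qed.

Definition delay_pt t (t1 : -1 <= t <= 0) : delay R.
Proof.
by exists t; rewrite inE /delay /= in_itv.
Defined.

(** The default value 0 is only taken off the continuous functions. *)
Definition restr x : C10 R := insubd 0 (fun theta : delay R => x (\val theta)).

Lemma restrE x theta : continuous x -> restr x theta = x (\val theta).
Proof.
move=> cx; have mx : (fun theta : delay R => x (\val theta)) \in @cont10 R.
  apply/asboolP => u.
  by apply: continuous_comp; [exact: initial_continuous|exact: cx].
by rewrite /restr -[LHS]/(val (insubd 0 _) theta) insubdK.
Qed.

Lemma C10_extension phi : exists2 x, continuous x &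
  forall theta, x (\val theta) = phi theta.
Proof.
have cf : {within delay R, continuous (valL_ 0 (phi : delay R -> R))}.
  by apply/subspace_valL_continuousP'; exact: C10_continuous.
pose cl t : R := Num.max (Num.min t 0) (-1).
exists (fun t => valL_ 0 (phi : delay R -> R) (cl t)).
  apply: (within_continuous_comp cf).
    exact: cts_comp (@cts_max R (-1)) (@cts_min R 0).
  move=> t; rewrite /delay /= in_itv/= /cl le_max lexx orbT/= ge_max ge_min lexx orbT/=.
  by lra.
move=> theta; have /andP[t1 t0] := delay_itv theta.
have -> : cl (\val theta) = \val theta by rewrite /cl min_l// max_l.
by have := congr1 (@^~ theta) (valLK 0 (phi : delay R -> R)).
Qed.

Definition line_sol a b c phi : R -> R :=
  get [set x | full_sol a b c x /\ forall theta, x (\val theta) = phi theta].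

Lemma line_solP a b c phi : c != 0 ->
  full_sol a b c (line_sol a b c phi) /\
  forall theta, line_sol a b c phi (\val theta) = phi theta.
Proof.
move=> c0.
apply: (@getPex _ [set x | full_sol a b c x /\
  forall theta, x (\val theta) = phi theta]).
have [f cf fphi] := C10_extension phi.
have [x fx xf] := full_sol_exists a b c0 cf.
by exists x; split=> // theta; rewrite xf ?fphi// delay_itv.
Qed.

Lemma line_sol_continuous a b c phi : c != 0 -> continuous (line_sol a b c phi).
Proof. by move=> c0; have [[cs _] _] := line_solP a b phi c0; exact: cs. Qed.

Lemma line_solE a b c phi x : c != 0 -> full_sol a b c x ->
  (forall theta, x (\val theta) = phi theta) -> line_sol a b c phi = x.
Proof.
move=> c0 fx xphi; have [fs sphi] := line_solP a b phi c0.
apply: full_sol_uniq fs fx _ => // t t1.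
by rewrite -[t]/(\val (delay_pt t1)) sphi xphi.
Qed.

Lemma line_sol_restr a b c x : c != 0 -> full_sol a b c x ->
  line_sol a b c (restr x) = x.
Proof. by move=> c0 fx; apply: line_solE => // theta; rewrite restrE//; case: fx. Qed.

Lemma restr_line_sol a b c phi : c != 0 -> restr (line_sol a b c phi) = phi.
Proof.
move=> c0; have [[cs _] sphi] := line_solP a b phi c0.
by apply: C10_ext => theta; rewrite restrE.
Qed.

Lemma C10_addE phi psi theta : (phi + psi) theta = phi theta + psi theta.
Proof. by []. Qed.

Lemma C10_scaleE k phi theta : (k *: phi) theta = k * phi theta.
Proof. by []. Qed.

Lemma line_sol_lin a b c k phi psi : c != 0 ->
  line_sol a b c (k *: phi + psi) = (fun t => k * line_sol a b c phi t + line_sol a b c psi t).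
Proof.
move=> c0; have [f1 E1] := line_solP a b phi c0; have [f2 E2] := line_solP a b psi c0.
apply: line_solE => //; first exact: full_sol_lin.
by move=> theta; rewrite E1 E2.
Qed.

Definition flow a b c t phi : C10 R := restr (fun s => line_sol a b c phi (s + t)).

Lemma flowE a b c t phi theta : c != 0 ->
  flow a b c t phi theta = line_sol a b c phi (\val theta + t).
Proof. by move=> c0; rewrite restrE//; apply: cts_shift; exact: line_sol_continuous. Qed.

Lemma line_sol_flow a b c t phi : c != 0 ->
  line_sol a b c (flow a b c t phi) = (fun s => line_sol a b c phi (s + t)).
Proof.
move=> c0; rewrite line_sol_restr//; apply: full_sol_shift.
by case: (line_solP a b phi c0).
Qed.

Lemma flowD a b c s t phi : c != 0 ->
  flow a b c s (flow a b c t phi) = flow a b c (s + t) phi.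
Proof.
by move=> c0; apply: C10_ext => theta; rewrite !flowE// line_sol_flow// addrA.
Qed.

Lemma flow0 a b c phi : c != 0 -> flow a b c 0 phi = phi.
Proof.
move=> c0; apply: C10_ext => theta; rewrite flowE// addr0.
by case: (line_solP a b phi c0).
Qed.

Lemma flowNK a b c t phi : c != 0 -> flow a b c t (flow a b c (- t) phi) = phi.
Proof. by move=> c0; rewrite flowD// subrr flow0. Qed.

Lemma flowKN a b c t phi : c != 0 -> flow a b c (- t) (flow a b c t phi) = phi.
Proof. by move=> c0; rewrite flowD// addNr flow0. Qed.

Lemma flow_lin a b c t k phi psi : c != 0 ->
  flow a b c t (k *: phi + psi) = k *: flow a b c t phi + flow a b c t psi.
Proof.
move=> c0; apply: C10_ext => theta.
by rewrite C10_addE C10_scaleE !flowE// line_sol_lin.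
Qed.

Lemma full_sol_neutral a b c phi : c != 0 ->
  neutral_solution a b c phi (line_sol a b c phi).
Proof.
move=> c0; have [[cs ds] sphi] := line_solP a b phi c0.
split=> //; first exact: continuous_subspaceT.
split.
  by apply: continuous_subspaceT; apply: ctsB; apply: ctsZ => //; exact: cts_shift.
move=> t t0; have [dd dE] := ds t.
rewrite -dE; apply: cvg_trans; last exact: dd.
apply: cvg_trans (cvg_app _ (@cvg_within _ _ _ _)) _; apply: near_eq_cvg.
apply: nearW => h; by rewrite /GRing.scale /= mulr1 [h + t]addrC.
Qed.

(** A solution for nonnegative times is only known to be continuous on [[-1, +oo[];
    composing with the retraction of the line onto that half-line makes its
    difference with a solution on the line continuous everywhere. *)
Lemma neutral_full_sol a b c phi x : c != 0 -> neutral_solution a b c phi x ->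
  forall t, -1 <= t -> x t = line_sol a b c phi t.
Proof.
move=> c0 [cx xphi [_ dx]]; have [[cs ds] sphi] := line_solP a b phi c0.
set z := line_sol a b c phi in cs ds sphi *.
pose m t : R := Num.max t (-1).
have cm : continuous m by exact: cts_max.
have mE t : -1 <= t -> m t = t by move=> t1; rewrite /m max_l.
have m1 t : -1 <= m t by rewrite /m le_max lexx orbT.
pose d t := x (m t) - z (m t).
have cd : continuous d.
  apply: ctsB; last exact: cts_comp cs cm.
  apply: (within_continuous_comp cx cm) => t.
  by rewrite /= in_itv/= m1.
have d0 t : -1 <= t <= 0 -> d t = 0.
  move=> t1; rewrite /d mE; last by case/andP: t1.
  by rewrite -[t]/(\val (delay_pt t1)) xphi sphi subrr.
move=> t t1; apply/eqP; rewrite -subr_eq0.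
have -> : x t - z t = d t by rewrite /d mE.
have [t0|/ltW t0] := leP t 0; first by rewrite d0// t1.
apply/eqP; apply: (vanishing_forward cd d0) t0 => {t1} t t0.
have dE s : -1 <= s -> d s = x s - z s by move=> s1; rewrite /d mE.
clearbody d; pose y s := (x s + c * x (s - 1)) - (z s + c * z (s - 1)).
have dy : is_derive t 1 y ((- a * x t - b * x (t - 1)) - (- a * z t - b * z (t - 1))).
  apply: drvB (ds t).
  have H := dx t (ltW t0).
  have H' : h^-1 *: (((fun s => x s + c * x (s - 1)) \o shift t) (h *: (1:R)) -
       (x t + c * x (t - 1))) @[h --> (0:R)^'] --> - a * x t - b * x (t - 1).
    move=> P /H HP.
    have HD : \forall h \near (0:R)^', 0 <= t + h.
      near=> h; rewrite -lerBlDl sub0r lerNl.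
      rewrite (le_trans (ler_norm _))// normrN ltW//.
      by near: h; apply: dnbhs0_lt.
    have HP' : \forall h \near (0:R)^', 0 <= t + h ->
        P (h^-1 * ((x (t + h) + c * x (t + h - 1)) - (x t + c * x (t - 1)))).
      exact: HP.
    rewrite -[nbhs _ P]/(\forall h \near (0:R)^', P (h^-1 *
      ((x (h * 1 + t) + c * x (h * 1 + t - 1)) - (x t + c * x (t - 1))))).
    apply: (filterS2 _ _ HP' HD) => h HP0 Dh.
    by rewrite mulr1 [h + t]addrC; exact: HP0.
  by split; [apply/cvg_ex; eexists; exact: H'|exact: cvg_lim H'].
have dy' : is_derive t 1 y (- a * d t - b * d (t - 1)).
  by apply: drv_val dy _; rewrite (dE t); [rewrite (dE (t - 1)); [ring|lra]|lra].
have yE (s : R) : 0 < s -> y s = d s + c * d (s - 1).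
  move=> s0; rewrite /y (dE s); last by lra.
  by rewrite (dE (s - 1)); [ring|lra].
apply: near_eq_is_derive dy'.
exact: (filterS yE (lt_nbhsr t0)).
Unshelve. all: by end_near. Qed.

Lemma solution_operatorE a b c t phi : c != 0 -> 0 <= t ->
  solution_operator a b c t phi = flow a b c t phi.
Proof.
move=> c0 t0; rewrite /solution_operator.
have ne : [set psi : C10 R | exists2 x, neutral_solution a b c phi x &
    forall theta : delay R, psi theta = x (t + \val theta)] !=set0.
  exists (flow a b c t phi); exists (line_sol a b c phi); first exact: full_sol_neutral.
  by move=> theta; rewrite flowE// addrC.
have [x nx E] := getPex ne.
apply: C10_ext => theta; rewrite E flowE// addrC.
by apply: (neutral_full_sol c0 nx); have /andP[] := delay_itv theta; lra.
Qed.

End flow.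

(** * Splittings of the flow and characteristic exponents *)

Section splittings.
Variable R : realType.
Implicit Types (a b c s t k r : R) (x z : R -> R) (phi psi : C10 R)
  (P Q : C10 R -> C10 R).

Lemma exp_decay_le0 r k s : 0 < s ->
  (forall t, 0 <= t -> r <= k * expR (- s * t)) -> r <= 0.
Proof.
move=> s0 H; rewrite leNgt; apply/negP => r0.
have k0 : 0 < k by have := H 0 (lexx 0); rewrite mulr0 expR0 mulr1; lra.
have t0 : 0 <= k / (r * s) by rewrite divr_ge0// ltW// mulr_gt0.
have := H _ t0; rewrite mulNr expRN -ler_pdivrMr ?invr_gt0 ?expR_gt0// invrK.
have := expR_ge1Dx (s * (k / (r * s))).
have -> : s * (k / (r * s)) = k / r by field; rewrite !gt_eqF.
move=> E1 E2; have : r * (1 + k / r) <= k.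
  by rewrite (le_trans _ E2)// ler_pM2l.
by rewrite mulrDr mulr1 mulrCA divff ?gt_eqF// mulr1; lra.
Qed.

Lemma norm_le_C10 phi k : (forall theta, `|phi theta| <= k) -> `|phi| <= k.
Proof. exact: supnorm_le. Qed.

Lemma le_norm_C10 phi theta : `|phi theta| <= `|phi|.
Proof. exact: le_supnorm. Qed.

(** The content of an exponential dichotomy in terms of the solutions on the
    whole line; [P] is the unstable projection. It makes the two projections
    play symmetric roles under the reversal of time. *)
Definition splits a b c P beta alpha : Prop :=
  [/\ beta < alpha, linear P,
      (forall t phi, flow a b c t (P phi) = P (flow a b c t phi)) &
      exists2 K, 0 <= K & forall t phi, 0 <= t ->
        `|flow a b c t (phi - P phi)| <= K * expR (beta * t) * `|phi| /\
        `|flow a b c (- t) (P phi)| <= K * expR (- alpha * t) * `|phi|].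

Lemma flowB a b c t phi psi : c != 0 ->
  flow a b c t (phi - psi) = flow a b c t phi - flow a b c t psi.
Proof.
by move=> c0; rewrite addrC -scaleN1r flow_lin// scaleN1r addrC.
Qed.

(** The stable part of [phi] is the image under [flow t] of the stable part of
    [flow (- t) phi], hence at most of order [exp ((beta - r) t)] for every [t]. *)
Lemma splits_unstable a b c P beta alpha phi k r : c != 0 ->
  splits a b c P beta alpha -> beta < r ->
  (forall t, 0 <= t -> `|flow a b c (- t) phi| <= k * expR (- r * t)) ->
  P phi = phi.
Proof.
move=> c0 [_ lP cP [K K0 bP]] br H.
apply/esym/eqP; rewrite -subr_eq0 -normr_le0.
apply: (@exp_decay_le0 _ (K * k) (r - beta)); first by rewrite subr_gt0.
move=> t t0; have := (bP t (flow a b c (- t) phi) t0).1.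
rewrite -cP flowB// !flowNK// => /le_trans; apply.
have -> : - (r - beta) * t = beta * t + (- r * t) by ring.
rewrite expRD.
have -> : K * k * (expR (beta * t) * expR (- r * t)) =
  K * expR (beta * t) * (k * expR (- r * t)) by ring.
by rewrite ler_wpM2l ?mulr_ge0 ?expR_ge0// H.
Qed.

Lemma splits_stable a b c P beta alpha phi k r : c != 0 ->
  splits a b c P beta alpha -> r < alpha ->
  (forall t, 0 <= t -> `|flow a b c t phi| <= k * expR (r * t)) ->
  P phi = 0.
Proof.
move=> c0 [_ lP cP [K K0 bP]] ra H.
apply/eqP; rewrite -normr_le0.
apply: (@exp_decay_le0 _ (K * k) (alpha - r)); first by rewrite subr_gt0.
move=> t t0; have := (bP t (flow a b c t phi) t0).2.
rewrite -cP !flowKN// => /le_trans; apply.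
have -> : - (alpha - r) * t = - alpha * t + r * t by ring.
rewrite expRD.
have -> : K * k * (expR (- alpha * t) * expR (r * t)) =
  K * expR (- alpha * t) * (k * expR (r * t)) by ring.
by rewrite ler_wpM2l ?mulr_ge0 ?expR_ge0// H.
Qed.

(** An unstable solution of the second splitting decays backwards too fast to have
    a stable part for the first one, and symmetrically. *)
Lemma splits_nested a b c P1 P2 beta1 alpha1 beta2 alpha2 : c != 0 ->
  splits a b c P1 beta1 alpha1 -> splits a b c P2 beta2 alpha2 ->
  beta1 < alpha2 -> forall phi, P1 (P2 phi) = P2 phi /\ P2 (P1 phi) = P2 phi.
Proof.
move=> c0 s1 s2 ba phi.
have [_ l1 _ [K1 K10 b1]] := s1; have [_ l2 _ [K2 K20 b2]] := s2.
split.
  apply: (@splits_unstable _ _ _ _ _ _ _ (K2 * `|phi|) _ c0 s1 ba) => t t0.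
  by rewrite mulrAC; exact: (b2 _ _ t0).2.
have : P2 (phi - P1 phi) = 0.
  apply: (@splits_stable _ _ _ _ _ _ _ (K1 * `|phi|) _ c0 s2 ba) => t t0.
  by rewrite mulrAC; exact: (b1 _ _ t0).1.
rewrite addrC -scaleN1r l2 scaleN1r addrC => /eqP; rewrite subr_eq0 => /eqP.
by [].
Qed.

(** Different dichotomies therefore have disjoint open gaps from [beta] to
    [alpha]. *)
Lemma splits_overlap a b c P1 P2 beta1 alpha1 beta2 alpha2 : c != 0 ->
  splits a b c P1 beta1 alpha1 -> splits a b c P2 beta2 alpha2 ->
  beta1 < alpha2 -> beta2 < alpha1 -> P1 = P2.
Proof.
move=> c0 s1 s2 b1 b2; apply/funext => phi.
by rewrite -(splits_nested c0 s1 s2 b1 phi).2 (splits_nested c0 s2 s1 b2 phi).1.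
Qed.

(** Characteristic exponents mu + i w: the real and imaginary parts of
    lambda + a + (c lambda + b) exp(- lambda) = 0. *)
Definition char_root a b c mu w : Prop :=
  mu + a + expR (- mu) * ((c * mu + b) * cos w + c * w * sin w) = 0 /\
  w + expR (- mu) * (c * w * cos w - (c * mu + b) * sin w) = 0.

Definition cosmode mu w t := expR (mu * t) * cos (w * t).
Definition sinmode mu w t := expR (mu * t) * sin (w * t).

Lemma drv_cosmode mu w t : is_derive t (1 : R) (cosmode mu w)
  (mu * cosmode mu w t - w * sinmode mu w t).
Proof.
apply: drv_val (drvM (drv_expl mu t) (drv_cosl w t)) _.
by rewrite /cosmode /sinmode; ring.
Qed.

Lemma drv_sinmode mu w t : is_derive t (1 : R) (sinmode mu w)
  (mu * sinmode mu w t + w * cosmode mu w t).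
Proof.
apply: drv_val (drvM (drv_expl mu t) (drv_sinl w t)) _.
by rewrite /cosmode /sinmode; ring.
Qed.

Lemma cosmode_continuous mu w : continuous (cosmode mu w).
Proof. by move=> t; exact: drv_cont (drv_cosmode mu w t). Qed.

Let modeB1 mu w t : cosmode mu w (t - 1) =
  expR (- mu) * (cos w * cosmode mu w t + sin w * sinmode mu w t).
Proof.
rewrite /cosmode /sinmode; have -> : mu * (t - 1) = - mu + mu * t by ring.
have -> : w * (t - 1) = w * t - w by ring.
by rewrite expRD cosB; ring.
Qed.

Let smodeB1 mu w t : sinmode mu w (t - 1) =
  expR (- mu) * (cos w * sinmode mu w t - sin w * cosmode mu w t).
Proof.
rewrite /cosmode /sinmode; have -> : mu * (t - 1) = - mu + mu * t by ring.
have -> : w * (t - 1) = w * t + - w by ring.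
by rewrite expRD sinD cosN sinN; ring.
Qed.

Let drv_mode c mu w t : is_derive t 1
  (fun s => cosmode mu w s + c * cosmode mu w (s - 1))
  ((mu * cosmode mu w t - w * sinmode mu w t) +
   c * (mu * cosmode mu w (t - 1) - w * sinmode mu w (t - 1))).
Proof.
by apply: drvD; [exact: drv_cosmode|apply: drvZ; apply: drv_shift; exact: drv_cosmode].
Qed.

Let drv_smode c mu w t : is_derive t 1
  (fun s => sinmode mu w s + c * sinmode mu w (s - 1))
  ((mu * sinmode mu w t + w * cosmode mu w t) +
   c * (mu * sinmode mu w (t - 1) + w * cosmode mu w (t - 1))).
Proof.
by apply: drvD; [exact: drv_sinmode|apply: drvZ; apply: drv_shift; exact: drv_sinmode].
Qed.

Lemma full_sol_cosmode a b c mu w : char_root a b c mu w ->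
  full_sol a b c (cosmode mu w).
Proof.
move=> [E1 E2]; split; first exact: cosmode_continuous.
move=> t; apply: drv_val (drv_mode c mu w t) _.
rewrite !modeB1 !smodeB1; apply/eqP; rewrite -subr_eq0; apply/eqP.
transitivity
  (cosmode mu w t * (mu + a + expR (- mu) * ((c * mu + b) * cos w + c * w * sin w))
   - sinmode mu w t * (w + expR (- mu) * (c * w * cos w - (c * mu + b) * sin w))).
  by ring.
by rewrite E1 E2 !mulr0 subrr.
Qed.

(** The converse is read off the equation at time 0. *)
Lemma char_root_modes a b c mu w : full_sol a b c (cosmode mu w) ->
  full_sol a b c (sinmode mu w) -> char_root a b c mu w.
Proof.
have c00 : cosmode mu w 0 = 1 by rewrite /cosmode !mulr0 expR0 cos0 mulr1.
have s00 : sinmode mu w 0 = 0 by rewrite /sinmode !mulr0 expR0 sin0 mulr0.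
move=> [_ dc] [_ ds]; split.
  have := drv_uniq (dc 0) (drv_mode c mu w 0).
  by rewrite !modeB1 !smodeB1 c00 s00; lra.
have := drv_uniq (ds 0) (drv_smode c mu w 0).
by rewrite !modeB1 !smodeB1 c00 s00; lra.
Qed.

Lemma cosmode_le mu w t : `|cosmode mu w t| <= expR (mu * t).
Proof.
rewrite /cosmode normrM ger0_norm ?expR_ge0//.
by rewrite ler_piMr ?expR_ge0// cos_max.
Qed.

Lemma expR_delay_le r k (theta : delay R) : expR (r * (\val theta + k)) <=
  expR `|r| * expR (r * k) :> R.
Proof.
rewrite -expRD ler_expR mulrDr lerD2r.
have /andP[t1 t0] := delay_itv theta.
have [r0|r0] := leP 0 r.
  by rewrite (@le_trans _ _ 0)// mulr_ge0_le0.
rewrite ler0_norm ?(ltW r0)//; nra.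
Qed.

Lemma splits_cosmode_unstable a b c P beta alpha mu w : c != 0 ->
  splits a b c P beta alpha -> char_root a b c mu w -> beta < mu ->
  P (restr (cosmode mu w)) = restr (cosmode mu w).
Proof.
move=> c0 sP rt bm.
apply: (@splits_unstable _ _ _ _ _ _ _ (expR `|mu|) mu c0 sP bm) => t t0.
apply: norm_le_C10 => theta; rewrite flowE// line_sol_restr//; last exact: full_sol_cosmode.
by rewrite (le_trans (cosmode_le _ _ _))// mulNr -mulrN expR_delay_le.
Qed.

Lemma splits_cosmode_stable a b c P beta alpha mu w : c != 0 ->
  splits a b c P beta alpha -> char_root a b c mu w -> mu < alpha ->
  P (restr (cosmode mu w)) = 0.
Proof.
move=> c0 sP rt ma.
apply: (@splits_stable _ _ _ _ _ _ _ (expR `|mu|) mu c0 sP ma) => t t0.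
apply: norm_le_C10 => theta; rewrite flowE// line_sol_restr//; last exact: full_sol_cosmode.
by rewrite (le_trans (cosmode_le _ _ _))// expR_delay_le.
Qed.

End splittings.

(** * A characteristic exponent between two gaps *)

Section between.
Variable R : realType.
Variables (a b c alpha beta : R).
Hypothesis c0 : c != 0.
Implicit Types (s t k r : R) (x z : R -> R).

(** The solutions that are unstable for a gap ending at [alpha] and stable for one
    beginning at [beta] are of this order at both ends of the line. *)
Definition weight t := expR (alpha * Num.min t 0 + beta * Num.max t 0).

Definition tempered x : Prop :=
  full_sol a b c x /\ exists C, forall t, `|x t| <= C * weight t.

Lemma weight_neg t : t <= 0 -> weight t = expR (alpha * t).
Proof. by move=> t0; rewrite /weight min_l// max_r// mulr0 addr0. Qed.

Lemma weight_pos t : 0 <= t -> weight t = expR (beta * t).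
Proof. by move=> t0; rewrite /weight min_r// max_l// mulr0 add0r. Qed.

Lemma weight_gt0 t : 0 < weight t.
Proof. exact: expR_gt0. Qed.

Lemma weight_shift t s : weight (t + s) <=
  expR ((`|alpha| + `|beta|) * `|s|) * weight t.
Proof.
rewrite /weight -expRD ler_expR.
have mn : `|Num.min (t + s) 0 - Num.min t 0| <= `|s|.
  by rewrite ler_norml; case: (leP (t + s) 0) => ?; case: (leP t 0) => ?;
    case: (ger0P s) => ?; apply/andP; split; lra.
have mx : `|Num.max (t + s) 0 - Num.max t 0| <= `|s|.
  by rewrite ler_norml; case: (leP (t + s) 0) => ?; case: (leP t 0) => ?;
    case: (ger0P s) => ?; apply/andP; split; lra.
have Ha : alpha * (Num.min (t + s) 0 - Num.min t 0) <= `|alpha| * `|s|.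
  by rewrite (le_trans (ler_norm _))// normrM ler_wpM2l.
have Hb : beta * (Num.max (t + s) 0 - Num.max t 0) <= `|beta| * `|s|.
  by rewrite (le_trans (ler_norm _))// normrM ler_wpM2l.
lra.
Qed.

Lemma tempered_lin k x z : tempered x -> tempered z ->
  tempered (fun t => k * x t + z t).
Proof.
move=> [fx [C xC]] [fz [D zD]]; split; first exact: full_sol_lin.
exists (`|k| * C + D) => t; rewrite (le_trans (ler_normD _ _))//.
by rewrite mulrDl lerD// normrM -mulrA ler_wpM2l.
Qed.

Lemma tempered0 : tempered (fun _ => 0).
Proof.
split; last by exists 0 => t; rewrite normr0 mul0r.
split; first exact: cts_cst.
have -> : (fun s : R => 0 + c * 0) = (fun _ => 0) by apply/funext => s; ring.
by move=> t; apply: drv_val (drv_cst _ _) _; ring.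
Qed.

Lemma tempered_sum n (k : 'I_n -> R) (x : 'I_n -> R -> R) :
  (forall i, tempered (x i)) -> tempered (fun t => \sum_i k i * x i t).
Proof.
move=> Tx; elim: n k x Tx => [|n IH] k x Tx.
  have -> : (fun t => \sum_(i < 0) k i * x i t) = (fun _ => 0).
    by apply/funext => t; rewrite big_ord0.
  exact: tempered0.
have -> : (fun t => \sum_(i < n.+1) k i * x i t) = (fun t => k ord0 * x ord0 t +
    \sum_(i < n) k (lift ord0 i) * x (lift ord0 i) t).
  by apply/funext => t; rewrite big_ord_recl.
by apply: tempered_lin => //; apply: IH.
Qed.

Lemma tempered_shift s x : tempered x -> tempered (fun t => x (t + s)).
Proof.
move=> [fx [C xC]]; split; first exact: full_sol_shift.
exists (`|C| * expR ((`|alpha| + `|beta|) * `|s|)) => t.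
rewrite (le_trans (xC _))// (@le_trans _ _ (`|C| * weight (t + s)))//.
  by rewrite ler_wpM2r ?ler_norm// ltW ?weight_gt0.
by rewrite -mulrA ler_wpM2l// weight_shift.
Qed.

(** Up to the factor [s], these are the averages of [x] over the intervals
    [[t, t + s]]; they have one more derivative than [x]. *)
Lemma tempered_average s x : 0 <= s -> tempered x ->
  tempered (fun t => prim x (t + s) - prim x t).
Proof.
move=> s0 Tx; have [[cx dx] [C xC]] := Tx.
have cP := prim_continuous cx.
have cD : continuous (fun t => prim x (t + s) - prim x t).
  by apply: ctsB => //; exact: cts_shift.
split.
  split=> // t.
  pose y r := x r + c * x (r - 1).
  have cy : continuous y by apply: ctsD => //; apply: ctsZ; exact: cts_shift.
  have yE : y (t + s) - y t = - a * (prim x (t + s) - prim x t)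
      - b * (prim x (t - 1 + s) - prim x (t - 1)).
    pose g r := y (t + r) + a * prim x (t + r) + b * prim x (t + r - 1).
    have : g s = g 0.
      apply: derive_zero_eq s0 _ _.
        have ct : continuous (fun r => t + r) by apply: ctsD; [exact: cts_cst|exact: cts_id].
        apply: ctsD; first apply: ctsD.
        - exact: cts_comp cy ct.
        - by apply: ctsZ; exact: cts_comp cP ct.
        - by apply: ctsZ; exact: cts_comp (cts_shift (k := -1) cP) ct.
      move=> r _.
      have -> : g = (fun r => (fun q => y q + a * prim x q + b * prim x (q + -1)) (r + t)).
        by apply/funext => q; rewrite /g [t + q]addrC.
      apply: drv_val (drv_shift (drvD (drvD (dx (r + t)) (drvZ a (drv_prim (r + t) cx)))
        (drvZ b (primD (-1) (r + t) cx)))) _.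
      by ring.
    rewrite /g addr0; have -> : t - 1 + s = t + s - 1 by ring.
    by move=> E; lra.
  rewrite -yE.
  have dX r : is_derive r 1 (fun r => prim x (r + s) - prim x r) (x (r + s) - x r).
    by apply: drvB; [exact: primD|exact: drv_prim].
  apply: drv_val (drvD (dX t) (drvZ c (drv_shift (k := -1) (dX _)))) _.
  rewrite /y; have -> : t - 1 + s = t + s - 1 by ring.
  by ring.
exists (`|C| * expR ((`|alpha| + `|beta|) * s) * s) => t.
have ts : t <= t + s by rewrite lerDl.
have dP r : t < r < t + s -> is_derive r 1 (prim x) (x r) by move=> _; exact: drv_prim.
have xm r : t <= r <= t + s -> `|x r| <=
    `|C| * expR ((`|alpha| + `|beta|) * s) * weight t.
  move=> /andP[tr rs]; rewrite (le_trans (xC _))//.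
  rewrite (@le_trans _ _ (`|C| * weight r))//.
    by rewrite ler_wpM2r ?ler_norm// ltW ?weight_gt0.
  rewrite -mulrA ler_wpM2l//.
  have -> : r = t + (r - t) by ring.
  apply: (le_trans (weight_shift _ _)); apply: ler_wpM2r.
    exact/ltW/weight_gt0.
  rewrite ler_expR ler_wpM2l ?addr_ge0// ger0_norm ?subr_ge0//; lra.
have := mean_value_bound ts cP dP xm.
have -> : t + s - t = s by ring.
by rewrite mulrAC.
Qed.

Lemma tempered_uniq x : tempered x -> (forall t, -1 <= t <= 0 -> x t = 0) ->
  forall t, x t = 0.
Proof.
move=> [fx _] x0 t; have [f0 _] := tempered0.
by rewrite (full_sol_uniq c0 fx f0 x0).
Qed.

(** Averages over a short interval gain a derivative, which is again tempered since
    it is a difference of translates; they do not all vanish unless [x] does. *)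
Lemma smooth_tempered x n : tempered x -> (exists t, x t != 0) ->
  exists d : nat -> R -> R, [/\ forall i, (i <= n)%N -> tempered (d i),
    forall i t, (i < n)%N -> is_derive t 1 (d i) (d i.+1 t) &
    exists t, d 0%N t != 0].
Proof.
move=> Tx x0; elim: n => [|n [d [Td dd d0]]]; first by exists (fun _ => x); split.
have Td0 := Td 0%N isT; have [[cd _] _] := Td0.
have [s s0 [t0 dt0]] : exists2 s, 0 <= s &
    exists t, prim (d 0%N) (t + s) - prim (d 0%N) t != 0.
  apply: contrapT => H; have [t dt] := d0; move/eqP: dt; apply.
  have cst s t' : 0 <= s -> prim (d 0%N) (t' + s) = prim (d 0%N) t'.
    move=> s0; apply/eqP; rewrite -subr_eq0; apply/negPn/negP => N.
    by apply: H; exists s => //; exists t'.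
  have cst0 : prim (d 0%N) = (fun _ => prim (d 0%N) 0).
    apply/funext => r; have [r0|/ltW r0] := leP 0 r.
      by rewrite -{1}(add0r r) cst.
    by rewrite -(cst (- r) r) ?subrr// lerNr oppr0.
  have := drv_prim t cd; rewrite cst0 => dP.
  by rewrite (drv_uniq dP (drv_cst _ _)).
exists (fun i => if i is j.+1 then (fun t => d j (t + s) - d j t)
                 else (fun t => prim (d 0%N) (t + s) - prim (d 0%N) t)); split.
- case=> [_|j jn]; first exact: tempered_average.
  have -> : (fun t => d j (t + s) - d j t) = (fun t => (-1) * d j t + d j (t + s)).
    by apply/funext => t; ring.
  by apply: tempered_lin; [exact: Td|apply: tempered_shift; exact: Td].
- case=> [t _|j t jn].
    by apply: drvB; [exact: primD|exact: drv_prim].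
  by apply: drvB; [apply: drv_shift|]; apply: dd.
- by exists t0.
Qed.

Hypothesis alpha_gt : ln `|c| < alpha.
Variable K : R.
Hypothesis K0 : 0 <= K.
Hypothesis tempered_back : forall x, tempered x -> forall t, t <= 0 ->
  `|x t| <= K * expR (alpha * t) * `|restr x|.

Let q := `|c| * expR (- alpha).

Let q_itv : 0 <= q < 1.
Proof.
rewrite /q mulr_ge0 ?expR_ge0//= expRN ltr_pdivrMr ?expR_gt0// mul1r.
by rewrite -[`|c|]lnK ?posrE ?normr_gt0// ltr_expR.
Qed.

(** The supremum [S] of [D] satisfies [S <= A + q * S]. *)
Lemma contraction_bound (D : R -> R) (B A : R) :
  (forall t, t <= 0 -> D t <= B) -> (forall t, t <= 0 -> D t <= A + q * D (t - 1)) ->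
  forall t, t <= 0 -> D t <= A / (1 - q).
Proof.
have /andP[q0 q1] := q_itv.
move=> DB DA; pose S := D @` `]-oo, 0].
have S0 : S !=set0 by exists (D 0), 0 => //=; rewrite in_itv/=.
have uS : has_ubound S by exists B => _ [t /= t0 <-]; apply: DB; rewrite in_itv/= in t0.
have DS t : t <= 0 -> D t <= sup S.
  by move=> t0; apply: ub_le_sup => //; exists t => //=; rewrite in_itv.
have : sup S <= A + q * sup S.
  apply: ge_sup => // _ [t /= t0 <-]; rewrite in_itv/= in t0.
  rewrite (le_trans (DA _ t0))// lerD2l ler_wpM2l// DS//; lra.
move=> HS t t0; rewrite (le_trans (DS _ t0))// ler_pdivlMr ?subr_gt0//.
by rewrite mulrBr mulr1; lra.
Qed.

Let E := expR `|alpha|.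
Let G := (`|a| * E + `|b| * E ^+ 2) * K.
Let L := E * (G / (1 - q)).

Let G0 : 0 <= G.
Proof. by rewrite /G !(mulr_ge0, addr_ge0)// ?exprn_ge0// ?expR_ge0. Qed.

Let L0 : 0 <= L.
Proof.
have /andP[_ q1] := q_itv.
by rewrite /L mulr_ge0 ?expR_ge0// divr_ge0// subr_ge0 ltW.
Qed.

Let E1 : 1 <= E.
Proof. by rewrite /E -expR0 ler_expR. Qed.

Let expE t s : t - 1 <= s <= t -> expR (alpha * s) <= E * expR (alpha * t).
Proof.
move=> /andP[ts st]; rewrite /E -expRD ler_expR.
have [a0|a0] := leP 0 alpha; first by rewrite ger0_norm//; nra.
by rewrite ltr0_norm//; nra.
Qed.

(** With [y t = x t + c * x (t - 1)], the increments of [x] solve a difference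
    equation whose right member is an increment of the differentiable function
    [y]. As [|c| exp (- alpha) < 1] it can be solved backwards in the space of
    functions of order [exp (alpha t)]. *)
Lemma tempered_lipschitz x : tempered x -> forall t s, -1 <= t <= 0 -> 0 <= s <= 1 ->
  `|x t - x (t - s)| <= L * `|restr x| * s.
Proof.
move=> Tx t s /andP[t1 t0] /andP[s0 s1].
have [[cx dx] _] := Tx.
have /andP[q0 q1] := q_itv.
set M := `|restr x|; have M0 : 0 <= M by exact: normr_ge0.
have xb r : r <= 0 -> `|x r| <= K * expR (alpha * r) * M by exact: tempered_back.
pose y r := x r + c * x (r - 1).
have cy : continuous y by apply: ctsD => //; apply: ctsZ; exact: cts_shift.
have dy r : r <= 0 -> `|y r - y (r - s)| <= G * M * s * expR (alpha * r).
  move=> r0; have rs : r - s <= r by rewrite gerBl.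
  have H := mean_value_bound (m := G * M * expR (alpha * r)) rs cy (fun q _ => dx q).
  have -> : G * M * s * expR (alpha * r) = G * M * expR (alpha * r) * (r - (r - s)).
    by ring.
  apply: H => v /andP[rv vr].
  have v0 : v <= 0 by exact: le_trans r0.
  have Ev : expR (alpha * v) <= E * expR (alpha * r) by apply: expE; apply/andP; split; lra.
  have Ev1 : expR (alpha * (v - 1)) <= E ^+ 2 * expR (alpha * r).
    rewrite (@le_trans _ _ (E * expR (alpha * v)))//.
      by apply: expE; apply/andP; split; lra.
    by rewrite expr2 -mulrA ler_wpM2l// expR_ge0.
  rewrite (le_trans (ler_normB _ _))// !normrM normrN.
  have v10 : v - 1 <= 0 by lra.
  have KM0 : 0 <= K * M by rewrite mulr_ge0.
  have H1 : `|x v| <= K * M * (E * expR (alpha * r)).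
    by rewrite (le_trans (xb _ v0))// mulrAC ler_wpM2l.
  have H2 : `|x (v - 1)| <= K * M * (E ^+ 2 * expR (alpha * r)).
    by rewrite (le_trans (xb _ v10))// mulrAC ler_wpM2l.
  have H3 := ler_wpM2l (normr_ge0 a) H1.
  have H4 := ler_wpM2l (normr_ge0 b) H2.
  rewrite (le_trans (lerD H3 H4))// le_eqVlt; apply/orP; left; apply/eqP.
  by rewrite /G; ring.
pose D r := `|x r - x (r - s)| * expR (- alpha * r).
have DA r : r <= 0 -> D r <= G * M * s + q * D (r - 1).
  move=> r0; have := dy _ r0.
  have -> : y r - y (r - s) = (x r - x (r - s)) + c * (x (r - 1) - x (r - 1 - s)).
    rewrite /y; have -> : r - s - 1 = r - 1 - s by ring.
    by ring.
  move=> H.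
  have {}H : `|x r - x (r - s)| <=
      G * M * s * expR (alpha * r) + `|c| * `|x (r - 1) - x (r - 1 - s)|.
    rewrite -normrM; move: H; set u := x r - _; set v := c * _ => H.
    have -> : u = (u + v) - v by ring.
    by rewrite (le_trans (ler_normB _ _))// lerD2r.
  have {}H := ler_wpM2r (expR_ge0 (- alpha * r)) H.
  rewrite /D (le_trans H)// mulrDl lerD//.
    rewrite le_eqVlt; apply/orP; left; apply/eqP.
    transitivity (G * M * s * (expR (alpha * r) * expR (- alpha * r))).
      by ring.
    by rewrite -expRD mulNr subrr expR0 mulr1.
  rewrite /q le_eqVlt; apply/orP; left; apply/eqP.
  have -> : - alpha * (r - 1) = - alpha * r + alpha by ring.
  by rewrite expRD expRN; field; rewrite gt_eqF ?expR_gt0.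
have DB r : r <= 0 -> D r <= K * M * (1 + E).
  move=> r0; rewrite /D.
  have H1 := xb _ r0.
  have H2 : `|x (r - s)| <= K * M * (E * expR (alpha * r)).
    rewrite (le_trans (xb _ _))//; first lra.
    by rewrite mulrAC ler_wpM2l ?mulr_ge0// expE//; apply/andP; split; lra.
  have -> : K * M * (1 + E) =
      (K * expR (alpha * r) * M + K * M * (E * expR (alpha * r))) * expR (- alpha * r).
    transitivity (K * M * (1 + E) * (expR (alpha * r) * expR (- alpha * r))).
      by rewrite -expRD mulNr subrr expR0 mulr1.
    by ring.
  by rewrite ler_wpM2r ?expR_ge0// (le_trans (ler_normB _ _))// lerD.
have := contraction_bound DB DA t0; rewrite /D => H.
have H' : `|x t - x (t - s)| <= expR (alpha * t) * (G * M * s / (1 - q)).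
  have := ler_wpM2r (expR_ge0 (alpha * t)) H.
  rewrite -[X in X <= _]mulrA -expRD mulNr addNr expR0 mulr1.
  by rewrite [X in _ -> _ <= X]mulrC.
rewrite (le_trans H')//.
have -> : L * M * s = E * (G * M * s / (1 - q)) by rewrite /L; ring.
rewrite ler_wpM2r//.
  apply: divr_ge0; last by rewrite subr_ge0 ltW.
  exact: mulr_ge0 (mulr_ge0 G0 M0) s0.
by rewrite /E ler_expR; have := ler_norm alpha; have := ler_norm (- alpha);
  rewrite normrN; nra.
Qed.

Let N := (Num.truncn `|L|).+1.

Let ltLN : L < N%:R.
Proof. by rewrite (le_lt_trans (ler_norm _))// truncnS_gt. Qed.

(** By the Lipschitz estimate the supremum norm of a solution that vanishes on a
    grid of step [1 / N] is at most [L / N < 1] times itself. So the tempered solutions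
    form a space of dimension at most [N + 1]. *)
Lemma tempered_grid x : tempered x ->
  (forall j : 'I_N.+1, x (- (j%:R / N%:R)) = 0) -> forall t, x t = 0.
Proof.
move=> Tx x0; have [fx _] := Tx; have [cx _] := fx.
have N0 : 0 < N%:R :> R by rewrite ltr0n.
set M := `|restr x|.
have xs t : -1 <= t <= 0 -> `|x t| <= L / N%:R * M.
  move=> /andP[t1 t0].
  have tN : 0 <= - t * N%:R by rewrite mulr_ge0 ?oppr_ge0// ltW.
  pose j := Num.truncn (- t * N%:R).
  have /andP[j1 j2] := truncn_itv tN; rewrite -/j in j1 j2.
  have jN : (j < N.+1)%N.
    rewrite ltnS -(ler_nat R) (le_trans j1)//.
    by apply: ler_piMl; [exact: ltW|lra].
  have x0j := x0 (Ordinal jN); rewrite /= in x0j.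
  have {}j1 : j%:R / N%:R <= - t by rewrite ler_pdivrMr.
  have {}j2 : - t < j%:R / N%:R + N%:R^-1.
    by rewrite -[X in _ + X]mul1r -mulrDl natr1 ltr_pdivlMr.
  set r := j%:R / N%:R in j1 j2 x0j.
  have r0 : 0 <= r by rewrite /r divr_ge0.
  have N1 : N%:R^-1 <= 1 :> R by rewrite invf_le1// ler1n.
  have := tempered_lipschitz Tx (t := - r) (s := - r - t).
  have -> : - r - (- r - t) = t by ring.
  rewrite x0j sub0r normrN -/M => H.
  apply: (le_trans (H _ _)); [lra|lra|].
  rewrite [X in _ <= X]mulrAC; apply: ler_wpM2l; last by lra.
  by rewrite mulr_ge0 ?normr_ge0.
have ML : M <= L / N%:R * M.
  by apply: norm_le_C10 => theta; rewrite restrE// xs// delay_itv.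
have M0 : M <= 0.
  rewrite leNgt; apply/negP => Mgt; move: ML.
  by rewrite ler_pMl// ler_pdivlMr// mul1r leNgt ltLN.
apply: tempered_uniq => // t t1; apply/eqP; rewrite -normr_le0.
by rewrite (le_trans (xs _ t1))// mulr_ge0_le0// divr_ge0// ltW.
Qed.

Lemma linear_dependence m n (A : 'M[R]_(n, m)) : (m < n)%N ->
  exists2 r : 'rV[R]_n, r != 0 & r *m A = 0.
Proof.
move=> mn; have kA : kermx A != 0.
  rewrite -mxrank_eq0 mxrank_ker subn_eq0 -ltnNge.
  exact: leq_ltn_trans (rank_leq_col A) mn.
by have /rowV0Pn[r /sub_kermxP rA r0] := kA; exists r.
Qed.

Section exponential.
Variables (n : nat) (d : nat -> R -> R).
Hypothesis Td : forall i, (i <= n)%N -> tempered (d i).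
Hypothesis dd : forall i t, (i < n)%N -> is_derive t 1 (d i) (d i.+1 t).
Hypothesis d0 : exists t, d 0%N t != 0.

Local Notation CR := (complex R).
Implicit Type p : {poly CR}.

(** The differential operator [p(d/dt)], applied to [d 0]. *)
Let act p t : CR := \sum_(k < n.+1) p`_k * (d k t)%:C%C.

Let actZ lam p t : act (lam%:P * p) t = lam * act p t.
Proof. by rewrite /act big_distrr; apply: eq_bigr => k _ /=; rewrite coefCM mulrA. Qed.

Let actX p t :
  act ('X * p) t = \sum_(k < n) p`_k * (d k.+1 t)%:C%C.
Proof.
rewrite /act big_ord_recl coefXM eqxx mul0r add0r.
by apply: eq_bigr => k _; rewrite coefXM.
Qed.

Let actD p1 p2 t : act (p1 + p2) t = act p1 t + act p2 t.
Proof.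
by rewrite /act -big_split; apply: eq_bigr => k _ /=; rewrite coefD mulrDl.
Qed.

(** Divide linear factors out of a relation [p(d/dt) (d 0) = 0] one at a time. The
    first quotient that is no longer a relation yields a nonzero function, which the
    last factor, some [d/dt - lam], kills. *)
Let eigen_poly p : p != 0 -> (size p <= n.+1)%N -> (forall t, act p t = 0) ->
  exists (lam : CR) (q : {poly CR}), [/\ (size q <= n)%N, exists t, act q t != 0 &
    forall t, act ('X * q) t = lam * act q t].
Proof.
have [m] := ubnP (size p); elim: m p => [//|m IH] p pm p0 pn pE.
have [p1|p1] := eqVneq (size p) 1%N.
  have [t dt] := d0; have := pE t; rewrite /act big_ord_recl big1; last first.
    by move=> k _; rewrite nth_default ?mul0r// p1.
  rewrite addr0 => /eqP; rewrite mulf_eq0 => /orP[/eqP pc|].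
    by move: p0; rewrite (size1_polyC (eq_leq p1)) pc polyC0 eqxx.
  by rewrite eq_complex /= eqxx andbT (negPf dt).
have /closed_rootP[lam /factor_theorem[g pg]] := p1.
have g0 : g != 0 by apply: contraNneq p0 => g0; rewrite pg g0 mul0r.
have sg : size p = (size g).+1.
  by rewrite pg size_mul ?polyXsubC_eq0// size_XsubC addn2.
have [gE|/existsNP[t /eqP gt]] := pselect (forall t, act g t = 0).
  by apply: (IH g) => //; [rewrite -ltnS -sg|rewrite -ltnS -sg ltnW].
exists lam, g; split; [by rewrite -ltnS -sg|by exists t|move=> r].
have := pE r; have -> : p = 'X * g + (- lam)%:P * g by rewrite pg polyCN; ring.
by rewrite actD actZ mulNr => /eqP; rewrite subr_eq0 => /eqP.
Qed.

Let re_sum (k : nat) (F : 'I_k -> CR) :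
  complex.Re (\sum_i F i) = \sum_i complex.Re (F i).
Proof. by apply: (big_morph (@complex.Re R)) => //; case=> [? ?] [? ?]. Qed.

Let im_sum (k : nat) (F : 'I_k -> CR) :
  complex.Im (\sum_i F i) = \sum_i complex.Im (F i).
Proof. by apply: (big_morph (@complex.Im R)) => //; case=> [? ?] [? ?]. Qed.

Let drv_sum (k : nat) (r : 'I_k -> R) (f df : 'I_k -> R -> R) t :
  (forall i, is_derive t 1 (f i) (df i t)) ->
  is_derive t 1 (fun s => \sum_i r i * f i s) (\sum_i r i * df i t).
Proof.
elim: k r f df => [|k IH] r f df df'.
  have -> : (fun s => \sum_(i < 0) r i * f i s) = (fun _ => 0).
    by apply/funext => s; rewrite big_ord0.
  by rewrite big_ord0; exact: drv_cst.
have -> : (fun s => \sum_(i < k.+1) r i * f i s) = (fun s => r ord0 * f ord0 s +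
    \sum_(i < k) r (lift ord0 i) * f (lift ord0 i) s).
  by apply/funext => s; rewrite big_ord_recl.
rewrite big_ord_recl; apply: drvD (drvZ (r ord0) (df' ord0)) _.
exact: (IH (fun i => r (lift ord0 i)) (fun i => f (lift ord0 i))
           (fun i => df (lift ord0 i)) (fun i => df' (lift ord0 i))).
Qed.

Lemma tempered_modes (r : 'I_n.+1 -> R) : (exists j, r j != 0) ->
  (forall t, \sum_j r j * d j t = 0) ->
  exists mu w, tempered (cosmode mu w) /\ tempered (sinmode mu w).
Proof.
move=> [k0 rk0] rE.
pose p : {poly CR} := \poly_(k < n.+1) (r (inord k))%:C%C.
have pE (k : 'I_n.+1) : p`_k = (r k)%:C%C by rewrite coef_poly ltn_ord inord_val.
have p0 : p != 0.
  apply: contraNneq rk0 => p0; have := pE k0.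
  by rewrite p0 coef0 => /eqP; rewrite eq_sym eq_complex /= => /andP[].
have actp t : act p t = 0.
  rewrite /act; under eq_bigr => k _ do rewrite pE -rmorphM /=.
  by rewrite -rmorph_sum /= rE.
have [lam [q1 [sq q1t q1E]]] := eigen_poly p0 (size_poly _ _) actp.
have actE t : act q1 t = \sum_(k < n) q1`_k * (d k t)%:C%C.
  by rewrite /act big_ord_recr /= nth_default ?mul0r ?addr0.
pose u t := \sum_(k < n) complex.Re q1`_k * d k t.
pose v t := \sum_(k < n) complex.Im q1`_k * d k t.
have reM (z : CR) (y : R) : complex.Re (z * y%:C%C) = complex.Re z * y.
  by case: z => z1 z2 /=; rewrite mulr0 subr0.
have imM (z : CR) (y : R) : complex.Im (z * y%:C%C) = complex.Im z * y.
  by case: z => z1 z2 /=; rewrite mulr0 add0r.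
have uE t : complex.Re (act q1 t) = u t.
  by rewrite actE re_sum; apply: eq_bigr => k _; rewrite reM.
have vE t : complex.Im (act q1 t) = v t.
  by rewrite actE im_sum; apply: eq_bigr => k _; rewrite imM.
have Tu : tempered u.
  by apply: tempered_sum => i; apply: Td; rewrite ltnW.
have Tv : tempered v.
  by apply: tempered_sum => i; apply: Td; rewrite ltnW.
set mu := complex.Re lam; set w := complex.Im lam.
have lamM (y : CR) : complex.Re (lam * y) = mu * complex.Re y - w * complex.Im y /\
    complex.Im (lam * y) = mu * complex.Im y + w * complex.Re y.
  by rewrite /mu /w; move: lam y {q1E mu w} => [? ?] [? ?].
have du t : is_derive t 1 u (mu * u t - w * v t).
  have [rM _] := lamM (act q1 t); rewrite -uE -vE -rM -q1E actX// re_sum.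
  have -> : \sum_(i < n) complex.Re (q1`_i * (d i.+1 t)%:C%C) =
    \sum_(i < n) complex.Re q1`_i * d i.+1 t by apply: eq_bigr => k _; rewrite reM.
  by apply: (@drv_sum _ _ _ (fun i : 'I_n => d i.+1)) => i; exact: dd.
have dv t : is_derive t 1 v (mu * v t + w * u t).
  have [_ iM] := lamM (act q1 t); rewrite -uE -vE -iM -q1E actX// im_sum.
  have -> : \sum_(i < n) complex.Im (q1`_i * (d i.+1 t)%:C%C) =
    \sum_(i < n) complex.Im q1`_i * d i.+1 t by apply: eq_bigr => k _; rewrite imM.
  by apply: (@drv_sum _ _ _ (fun i : 'I_n => d i.+1)) => i; exact: dd.
(* u + i v is a multiple A + i B of the exponential of mu + i w *)
pose A t := expR (- mu * t) * (cos (w * t) * u t + sin (w * t) * v t).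
pose B t := expR (- mu * t) * (cos (w * t) * v t - sin (w * t) * u t).
have dA t : is_derive t 1 A 0.
  apply: drv_val (drvM (drv_expl (- mu) t) (drvD (drvM (drv_cosl w t) (du t))
    (drvM (drv_sinl w t) (dv t)))) _.
  by ring.
have dB t : is_derive t 1 B 0.
  apply: drv_val (drvM (drv_expl (- mu) t) (drvB (drvM (drv_cosl w t) (dv t))
    (drvM (drv_sinl w t) (du t)))) _.
  by ring.
have AE t : A t = A 0 by exact: is_derive_0_is_cst.
have BE t : B t = B 0 by exact: is_derive_0_is_cst.
have e1 t : expR (- mu * t) * expR (mu * t) = 1 :> R.
  by rewrite -expRD mulNr addNr expR0.
have normE t : A 0 ^+ 2 + B 0 ^+ 2 = expR (- mu * t) ^+ 2 * (u t ^+ 2 + v t ^+ 2).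
  rewrite -(AE t) -(BE t) -[RHS]mulr1 -(cos2Dsin2 (w * t)) /A /B; ring.
have cE t : A 0 * u t + B 0 * v t = (A 0 ^+ 2 + B 0 ^+ 2) * cosmode mu w t.
  rewrite (normE t) -(AE t) -(BE t).
  transitivity (expR (- mu * t) * (expR (- mu * t) * expR (mu * t)) *
     (u t ^+ 2 + v t ^+ 2) * cos (w * t)); first by rewrite e1 /A /B; ring.
  by rewrite /cosmode; ring.
have sE t : A 0 * v t - B 0 * u t = (A 0 ^+ 2 + B 0 ^+ 2) * sinmode mu w t.
  rewrite (normE t) -(AE t) -(BE t).
  transitivity (expR (- mu * t) * (expR (- mu * t) * expR (mu * t)) *
     (u t ^+ 2 + v t ^+ 2) * sin (w * t)); first by rewrite e1 /A /B; ring.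
  by rewrite /sinmode; ring.
set D := A 0 ^+ 2 + B 0 ^+ 2 in normE cE sE.
have D0 : D != 0.
  have [t qt] := q1t; apply: contraNneq qt => D0.
  have := normE t; rewrite D0 => /esym/eqP; rewrite mulf_eq0 sqrf_eq0.
  rewrite gt_eqF ?expR_gt0//= paddr_eq0 ?sqr_ge0// !sqrf_eq0 -uE -vE.
  by rewrite eq_complex.
exists mu, w; split.
  have -> : cosmode mu w = (fun t => (A 0 / D) * u t + ((B 0 / D) * v t + 0)).
    by apply/funext => t; apply: (mulfI D0); rewrite -cE; field.
  by apply: tempered_lin => //; apply: tempered_lin => //; exact: tempered0.
have -> : sinmode mu w = (fun t => (A 0 / D) * v t + ((- B 0 / D) * u t + 0)).
  by apply/funext => t; apply: (mulfI D0); rewrite -sE; field.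
by apply: tempered_lin => //; apply: tempered_lin => //; exact: tempered0.
Qed.

End exponential.

(** The derivatives of a smooth tempered solution live in a finite-dimensional
    space, so they are linearly dependent and [d/dt] has an eigenvector among their
    complex combinations. *)
Lemma tempered_char_root x : tempered x -> (exists t, x t != 0) ->
  exists mu w, char_root a b c mu w /\ alpha <= mu <= beta.
Proof.
move=> Tx x0.
have [d [Td dd d0]] := smooth_tempered N.+1 Tx x0.
pose M : 'M[R]_(N.+2, N.+1) := \matrix_(i, j) d i (- (j%:R / N%:R)).
have [r r0 rM] := linear_dependence M (ltnSn _).
have [k rk] : exists j, r 0 j != 0.
  by have /rV0Pn := r0.
have [||mu [w [Tc Ts]]] := tempered_modes Td dd d0 (r := fun j => r 0 j).
- by exists k.
- apply: tempered_grid => [|j].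
    by apply: tempered_sum => i; apply: Td; rewrite -ltnS.
  have := congr1 (fun B : 'rV[R]_N.+1 => B 0 j) rM; rewrite !mxE; apply: etrans.
  by apply: eq_bigr => i _; rewrite mxE.
have [fc [Cc cC]] := Tc; have [fs [Cs sC]] := Ts.
exists mu, w; split; first exact: char_root_modes.
have H t : expR (mu * t) ^+ 2 <= (Cc ^+ 2 + Cs ^+ 2) * weight t ^+ 2.
  have -> : expR (mu * t) ^+ 2 = `|cosmode mu w t| ^+ 2 + `|sinmode mu w t| ^+ 2.
    rewrite !real_normK ?num_real// /cosmode /sinmode !exprMn -mulrDr.
    by rewrite cos2Dsin2 mulr1.
  rewrite mulrDl -!exprMn lerD// lerXn2r ?nnegrE ?normr_ge0//.
    exact: le_trans (cC t).
  exact: le_trans (sC t).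
have expsq (r1 r2 : R) : expR r1 ^+ 2 = expR r2 * expR (r1 + r1 - r2).
  by rewrite expr2 -!expRD; congr expR; ring.
apply/andP; split; rewrite leNgt; apply/negP => bm.
- have : (1 : R) <= 0.
    apply: (@exp_decay_le0 _ _ (Cc ^+ 2 + Cs ^+ 2) (2 * (alpha - mu))).
      by rewrite mulr_gt0// subr_gt0.
    move=> t t0; have nt0 : - t <= 0 by lra.
    have := H (- t); rewrite weight_neg// (expsq (alpha * - t) (mu * - t + mu * - t)).
    rewrite expr2 -expRD mulrCA ler_pMr ?expR_gt0// => /le_trans; apply.
    by rewrite le_eqVlt; apply/orP; left; apply/eqP; congr (_ * expR _); ring.
  by rewrite ler10.
- have : (1 : R) <= 0.
    apply: (@exp_decay_le0 _ _ (Cc ^+ 2 + Cs ^+ 2) (2 * (mu - beta))).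
      by rewrite mulr_gt0// subr_gt0.
    move=> t t0.
    have := H t; rewrite weight_pos// (expsq (beta * t) (mu * t + mu * t)).
    rewrite expr2 -expRD mulrCA ler_pMr ?expR_gt0// => /le_trans; apply.
    by rewrite le_eqVlt; apply/orP; left; apply/eqP; congr (_ * expR _); ring.
  by rewrite ler10.
Qed.

End between.

Section root_between_splittings.
Variable R : realType.
Implicit Types (a b c s t k : R) (P : C10 R -> C10 R).

(** As the projections differ, some nonzero [phi] is unstable for the first
    splitting and stable for the second one; the constant of the first splitting
    bounds all the tempered solutions backwards. *)
Lemma root_between a b c P1 P2 beta1 alpha1 beta2 alpha2 : c != 0 ->
  splits a b c P1 beta1 alpha1 -> splits a b c P2 beta2 alpha2 ->
  P1 <> P2 -> alpha1 <= beta2 -> ln `|c| < alpha1 ->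
  exists mu w, char_root a b c mu w /\ alpha1 <= mu <= beta2.
Proof.
move=> c0 s1 s2 P12 a1b2 ca1.
have [ba1 l1 _ [K1 K10 b1]] := s1; have [ba2 l2 _ [K2 K20 b2]] := s2.
have b1a2 : beta1 < alpha2 by exact: lt_le_trans (lt_le_trans ba1 a1b2) (ltW ba2).
have nest := splits_nested c0 s1 s2 b1a2.
have [chi chiP] : exists chi, P1 chi != P2 chi.
  apply: contrapT => H; apply: P12; apply/funext => chi.
  by apply/eqP/negPn/negP => N; apply: H; exists chi.
pose phi := P1 chi - P2 chi.
have linB (P : C10 R -> C10 R) u v : linear P -> P (u - v) = P u - P v.
  by move=> lP; rewrite addrC -scaleN1r lP scaleN1r addrC.
have idem : P1 (P1 chi) = P1 chi.
  by have [] := splits_nested c0 s1 s1 ba1 chi.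
have idem2 : P2 (P2 chi) = P2 chi.
  by have [] := splits_nested c0 s2 s2 ba2 chi.
have P1phi : P1 phi = phi by rewrite /phi linB// (nest chi).1 idem.
have P2phi : P2 phi = 0 by rewrite /phi linB// (nest chi).2 idem2 subrr.
pose x := line_sol a b c phi.
have [fx xphi] := line_solP a b phi c0.
have cx : continuous x by exact: line_sol_continuous.
have x_at t : x t = flow a b c t phi (delay0 R).
  by rewrite flowE//= add0r.
have Tx : tempered a b c alpha1 beta2 x.
  split=> //; exists (Num.max K1 K2 * `|phi|) => t.
  rewrite x_at (le_trans (le_norm_C10 _ _))//.
  have [t0|/ltW t0] := leP t 0.
    have nt0 : 0 <= - t by rewrite oppr_ge0.
    have := (b1 (- t) phi nt0).2; rewrite P1phi opprK mulrNN weight_neg// => /le_trans; apply.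
    by rewrite mulrAC ler_wpM2r ?expR_ge0// ler_wpM2r ?normr_ge0// le_max lexx.
  have := (b2 t phi t0).1; rewrite P2phi subr0 weight_pos// => /le_trans; apply.
  by rewrite mulrAC ler_wpM2r ?expR_ge0// ler_wpM2r ?normr_ge0// le_max lexx orbT.
apply: (@tempered_char_root _ _ _ _ _ _ c0 ca1 K1 K10 _ x Tx).
  move=> z [fz [C zC]] t t0.
  have cz : continuous z by case: fz.
  have P1z : P1 (restr z) = restr z.
    apply: (@splits_unstable _ _ _ _ _ _ _ _ (`|C| * expR `|alpha1|) _ c0 s1 ba1).
    move=> r r0; apply: norm_le_C10 => theta; rewrite flowE// line_sol_restr//.
    have [th1 th0] := andP (delay_itv theta).
    have tr0 : \val theta + - r <= 0 by lra.
    rewrite (le_trans (zC _))// weight_neg//.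
    rewrite (@le_trans _ _ (`|C| * expR (alpha1 * (\val theta + - r))))//.
      by rewrite ler_wpM2r ?expR_ge0// ler_norm.
    by rewrite -mulrA ler_wpM2l// mulNr -mulrN expR_delay_le.
  have nt0 : 0 <= - t by rewrite oppr_ge0.
  have := (b1 (- t) (restr z) nt0).2; rewrite P1z opprK mulrNN.
  apply: le_trans; apply: le_trans (le_norm_C10 _ (delay0 R)).
  by rewrite flowE// line_sol_restr//= add0r.
apply: contrapT => H; move/eqP: chiP; apply; apply/eqP; rewrite -subr_eq0.
apply/eqP; rewrite -/phi -(restr_line_sol a b phi c0); apply: C10_ext => theta.
rewrite restrE//; apply/eqP/negPn/negP => N; apply: H.
by exists (\val theta).
Qed.

End root_between_splittings.

(** * The curve that carries the characteristic exponents *)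

Section characteristic_curve.
Variable R : realType.
Variables (a b c : R).
Hypothesis c0 : c != 0.
Implicit Types (mu nu w t r : R).

Definition sigma : R := ln `|c|.
(** Equality of moduli in [exp lambda * (lambda + a) = - (c lambda + b)] for
    [lambda = mu + i w] reads [w ^+ 2 * dcurve mu = gcurve mu]. *)
Definition gcurve mu := (c * mu + b) ^+ 2 - (expR mu * (mu + a)) ^+ 2.
Definition dcurve mu := expR mu ^+ 2 - c ^+ 2.
Definition kappa := gcurve sigma.
Definition slope := 2 * c * (b - a * c).

Lemma expR_sigma : expR sigma = `|c|.
Proof. by rewrite lnK// posrE normr_gt0. Qed.

Lemma expR_sigma2 : expR sigma ^+ 2 = c ^+ 2.
Proof. by rewrite expR_sigma real_normK// num_real. Qed.

Lemma c2_gt0 : 0 < c ^+ 2.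
Proof. by rewrite exprn_even_gt0. Qed.

Lemma char_root_curve mu w : char_root a b c mu w ->
  w ^+ 2 * dcurve mu = gcurve mu.
Proof.
move=> [E1 E2].
have e1 : expR mu * expR (- mu) = 1 by rewrite -expRD subrr expR0.
set B := c * mu + b in E1 E2 *.
have scale (u X : R) : u + expR (- mu) * X = 0 -> expR mu * u = - X.
  move=> H; apply/eqP; rewrite -addr_eq0; apply/eqP.
  by rewrite -[X in _ + X]mul1r -e1 -mulrA -mulrDr H mulr0.
have X := scale _ _ E1; have Y := scale _ _ E2.
rewrite /dcurve /gcurve X.
have -> : w ^+ 2 * (expR mu ^+ 2 - c ^+ 2) = (expR mu * w) ^+ 2 - (c * w) ^+ 2 by ring.
rewrite Y -/B; apply/eqP; rewrite -subr_eq0; apply/eqP.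
transitivity ((B ^+ 2 + (c * w) ^+ 2) * (cos w ^+ 2 + sin w ^+ 2 - 1)); first by ring.
by rewrite cos2Dsin2 subrr mulr0.
Qed.

Lemma dcurve_ge mu : sigma <= mu -> 2 * c ^+ 2 * (mu - sigma) <= dcurve mu.
Proof.
move=> sm; rewrite /dcurve.
have -> : expR mu ^+ 2 = c ^+ 2 * expR (2 * (mu - sigma)).
  by rewrite -expR_sigma2 !expr2 -!expRD; congr expR; ring.
have := ler_wpM2l (ltW c2_gt0) (expR_ge1Dx (2 * (mu - sigma))).
by lra.
Qed.

(** Above [sigma], [expR mu ^+ 2] is at least [c ^+ 2]; with [c ^+ 2] in its place
    [gcurve] becomes the affine function of the right member. *)
Lemma gcurve_le mu : sigma <= mu -> gcurve mu <= kappa + slope * (mu - sigma).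
Proof.
move=> sm; have D0 : 0 <= dcurve mu.
  apply: le_trans (dcurve_ge sm).
  by rewrite mulr_ge0 ?subr_ge0// mulr_ge0// ltW ?c2_gt0.
rewrite /kappa /slope /gcurve !exprMn expR_sigma2.
have := mulr_ge0 D0 (sqr_ge0 (mu + a)); rewrite /dcurve mulrBl; lra.
Qed.

Definition mu_max := `|a| + 1 + `|c| + `|b - a * c|.

Lemma char_root_le_max mu w : char_root a b c mu w -> mu <= mu_max.
Proof.
move=> /char_root_curve E; rewrite leNgt; apply/negP; rewrite /mu_max => H.
have ha := normr_ge0 a; have hc := normr_ge0 c; have hb := normr_ge0 (b - a * c).
have u1 : 1 <= mu + a by have := ler_norm (- a); rewrite normrN; lra.
have e1 : `|c| + `|b - a * c| < expR mu by have := expR_ge1Dx mu; lra.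
have D0 : 0 <= dcurve mu.
  rewrite /dcurve subr_ge0 -[c ^+ 2]real_normK ?num_real//.
  by rewrite lerXn2r ?nnegrE ?expR_ge0//; lra.
have B1 : `|c * mu + b| < expR mu * (mu + a).
  have -> : c * mu + b = c * (mu + a) + (b - a * c) by ring.
  rewrite (le_lt_trans (ler_normD _ _))// normrM [`|mu + a|]ger0_norm; last by lra.
  apply: (@le_lt_trans _ _ ((`|c| + `|b - a * c|) * (mu + a))); first by nra.
  by rewrite ltr_pM2r//; lra.
have : gcurve mu < 0.
  rewrite /gcurve subr_lt0 -[(c * mu + b) ^+ 2]real_normK ?num_real//.
  by rewrite ltrXn2r// nnegrE.
by rewrite -E ltNge mulr_ge0// sqr_ge0.
Qed.

Lemma gcurve_continuous : continuous gcurve.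
Proof.
have cl k : continuous (fun mu => c * mu + k).
  by apply: ctsD (@cts_cst R _); exact: ctsZ (@cts_id R).
have ca : continuous (fun mu => mu + a) by apply: ctsD (@cts_id R) (@cts_cst R a).
have ce : continuous (fun mu : R => expR mu) by exact: continuous_expR.
have -> : gcurve = (fun mu => (c * mu + b) * (c * mu + b) -
    (expR mu * (mu + a)) * (expR mu * (mu + a))).
  by apply/funext => mu; rewrite /gcurve !expr2.
by apply: ctsB; apply: ctsM => //; exact: ctsM.
Qed.

Lemma dcurve_continuous : continuous dcurve.
Proof.
have ce : continuous (fun mu : R => expR mu) by exact: continuous_expR.
have -> : dcurve = (fun mu => expR mu * expR mu - c ^+ 2).
  by apply/funext => mu; rewrite /dcurve expr2.
by apply: ctsB (@cts_cst R _); exact: ctsM.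
Qed.

Lemma right_near (f : R -> R) r k : continuous f -> f r < k ->
  exists2 e, 0 < e & forall t, r <= t <= r + e -> f t < k.
Proof.
move=> cf fk.
have : \forall t \near r, f t < k by exact: (cf r _ (lt_nbhsl fk)).
move=> /nbhs_ballP[e /= e0 He]; exists (e / 2); first by rewrite divr_gt0.
move=> t /andP[rt te]; apply: He; rewrite /ball/= ltr_distlC.
by apply/andP; split; lra.
Qed.

(** Above [sigma] the characteristic exponents lie on the curve
    [w ^+ 2 * dcurve mu = gcurve mu]; when [kappa] is positive this curve is,
    near [sigma], the graph of a decreasing function that tends to infinity. *)
Definition curve_mono (e : R) := forall mu nu, sigma <= mu -> mu < nu ->
  nu <= sigma + e -> gcurve nu * dcurve mu < gcurve mu * dcurve nu.

Lemma curve_monoP : 0 < kappa -> exists2 e, 0 < e & curve_mono e.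
Proof.
move=> k0.
pose s1 := `|sigma| + 1.
pose E2 := expR (sigma + 1) ^+ 2.
pose B0 := `|c| * (2 * `|c| * s1 + 2 * `|b|) + E2 * (2 * s1 + 2 * `|a|).
have s10 : 0 <= s1 by rewrite /s1 addr_ge0.
have B00 : 0 <= B0.
  by rewrite /B0 !(addr_ge0, mulr_ge0)// ?exprn_ge0 ?expR_ge0.
have [e1 e10 He1] : exists2 e, 0 < e & forall t, sigma <= t <= sigma + e ->
    - gcurve t < - (kappa / 2).
  apply: right_near; last by rewrite ltrN2 -/kappa; lra.
  by move=> t; apply: cvgN; exact: gcurve_continuous.
have [e2 e20 He2] : exists2 e, 0 < e & forall t, sigma <= t <= sigma + e ->
    B0 * dcurve t < kappa * c ^+ 2.
  apply: (@right_near (fun t => B0 * dcurve t)).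
    by apply: ctsZ; exact: dcurve_continuous.
  by rewrite /dcurve expR_sigma2 subrr mulr0 mulr_gt0// c2_gt0.
exists (Num.min 1 (Num.min e1 e2)); first by rewrite !lt_min ltr01 e10.
move=> mu nu sm mn; rewrite -lerBlDl !le_min => /and3P[n1 ne1 ne2].
have sn : sigma <= nu by lra.
have gmu : kappa / 2 < gcurve mu by have := He1 mu; rewrite ltrN2; apply; lra.
have Dmu : B0 * dcurve mu < kappa * c ^+ 2 by apply: He2; lra.
have Dmu0 : 0 <= dcurve mu.
  apply: le_trans (dcurve_ge sm).
  by rewrite mulr_ge0 ?subr_ge0// mulr_ge0// ltW ?c2_gt0.
have dD : 2 * c ^+ 2 * (nu - mu) <= dcurve nu - dcurve mu.
  have -> : dcurve nu - dcurve mu = expR nu ^+ 2 - expR mu ^+ 2 by rewrite /dcurve; ring.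
  have -> : expR nu ^+ 2 = expR mu ^+ 2 * expR (2 * (nu - mu)).
    by rewrite !expr2 -!expRD; congr expR; ring.
  have H := ler_wpM2l (sqr_ge0 (expR mu)) (expR_ge1Dx (2 * (nu - mu))).
  have : c ^+ 2 * (nu - mu) <= expR mu ^+ 2 * (nu - mu).
    by rewrite ler_wpM2r//; [lra|move: Dmu0; rewrite /dcurve subr_ge0].
  by lra.
have dG : gcurve nu - gcurve mu <= (nu - mu) * B0.
  have Emn : expR mu ^+ 2 <= expR nu ^+ 2.
    by rewrite lerXn2r ?nnegrE ?expR_ge0// ler_expR ltW.
  have H1 : gcurve nu - gcurve mu <= (nu - mu) *
      (c * (c * (mu + nu) + 2 * b) - expR mu ^+ 2 * (mu + nu + 2 * a)).
    rewrite /gcurve !exprMn.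
    have := ler_wpM2r (sqr_ge0 (nu + a)) Emn.
    by lra.
  apply: (le_trans H1); apply: ler_wpM2l; first by lra.
  have smn : `|mu + nu| <= 2 * s1.
    rewrite (le_trans (ler_normD _ _))// /s1.
    have := ler_norm sigma; have := ler_norm (- sigma); rewrite normrN => ? ?.
    have : `|mu| <= `|sigma| + 1 by rewrite ler_norml; apply/andP; split; lra.
    have : `|nu| <= `|sigma| + 1 by rewrite ler_norml; apply/andP; split; lra.
    by lra.
  rewrite /B0 (le_trans (ler_norm _))// (le_trans (ler_normB _ _))// lerD//.
    rewrite normrM ler_wpM2l// (le_trans (ler_normD _ _))// !normrM.
    by rewrite lerD// ?(ger0_norm (ler0n _ _))// -mulrA [2 * _]mulrCA ler_wpM2l.
  rewrite normrM ger0_norm ?sqr_ge0// ler_pM ?sqr_ge0//.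
    by rewrite /E2 lerXn2r ?nnegrE ?expR_ge0// ler_expR; lra.
  by rewrite (le_trans (ler_normD _ _))// lerD// normrM ger0_norm.
rewrite -subr_gt0.
have -> : gcurve mu * dcurve nu - gcurve nu * dcurve mu =
  gcurve mu * (dcurve nu - dcurve mu) - (gcurve nu - gcurve mu) * dcurve mu by ring.
have g0 : 0 <= gcurve mu by lra.
have H1 := ler_wpM2l g0 dD.
have H2 := ler_wpM2r Dmu0 dG.
have mn0 : 0 < nu - mu by lra.
have H3 : 0 < (nu - mu) * (2 * c ^+ 2 * gcurve mu - B0 * dcurve mu).
  rewrite mulr_gt0//; have := c2_gt0; nra.
by lra.
Qed.

End characteristic_curve.

(** * Characteristic exponents near the limit line *)

Section roots_near_line.
Variable R : realType.
Variables (a b c : R).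
Hypothesis c0 : c != 0.
Implicit Types (mu nu w t r : R).

Local Notation sigma := (sigma c).
Local Notation g := (gcurve a b c).
Local Notation D := (dcurve c).

Lemma ivt_zero (f : R -> R) u v : u <= v -> continuous f ->
  0 <= f u -> f v <= 0 -> exists2 x, u <= x <= v & f x = 0.
Proof.
move=> uv cf fu fv.
have [|x xuv fx] := @IVT _ f u v 0 uv (continuous_subspaceT cf).
  by rewrite ge_min le_max fu fv orbT.
by exists x => //; move: xuv; rewrite in_itv.
Qed.

Lemma dcurve_le mu nu : mu <= nu -> D mu <= D nu.
Proof.
by move=> mn; rewrite /dcurve lerD2r lerXn2r ?nnegrE ?expR_ge0// ler_expR.
Qed.

Lemma dcurve_gt0 mu : sigma < mu -> 0 < D mu.
Proof.
move=> sm; apply: lt_le_trans (dcurve_ge c0 (ltW sm)).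
by rewrite mulr_gt0 ?subr_gt0// mulr_gt0// c2_gt0.
Qed.

(** The imaginary parts of the solutions of [1 + c exp (- lambda) = 0], which lie
    on the line [Re lambda = sigma]. *)
Definition freq n : R := (if 0 < c then pi else 0) + (pi *+ 2) *+ n.

Lemma freqS n k : freq (n + k) = freq n + (pi *+ 2) *+ k.
Proof. by rewrite /freq mulrnDr addrA. Qed.

Lemma freq_ge n : n%:R <= freq n.
Proof.
have p2 := pi_ge2 R; have p0 := pi_ge0 R.
rewrite /freq -[n%:R]add0r lerD//; first by case: ifP.
by rewrite -[(pi *+ 2) *+ n]mulr_natr -[X in X <= _]mul1r ler_wpM2r// mulr2n; lra.
Qed.

Lemma c_sin_freq n w : c * sin w = - `|c| * sin (w - freq n).
Proof.
have -> : w = (w - freq n) + (if 0 < c then pi else 0) + (pi *+ 2) *+ n.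
  by rewrite /freq; ring.
rewrite [in RHS]/freq; set d := w - freq n.
have -> : d + (if 0 < c then pi else 0) + pi *+ 2 *+ n -
    ((if 0 < c then pi else 0) + pi *+ 2 *+ n) = d by ring.
rewrite (periodicn (@sinD2pi R)); case: ltrgtP c0 => // [c1|c1] _.
  by rewrite sinDpi gtr0_norm//; ring.
by rewrite addr0 ltr0_norm// opprK.
Qed.

Lemma c_cos_freq n w : c * cos w = - `|c| * cos (w - freq n).
Proof.
have -> : w = (w - freq n) + (if 0 < c then pi else 0) + (pi *+ 2) *+ n.
  by rewrite /freq; ring.
rewrite [in RHS]/freq; set d := w - freq n.
have -> : d + (if 0 < c then pi else 0) + pi *+ 2 *+ n -
    ((if 0 < c then pi else 0) + pi *+ 2 *+ n) = d by ring.
rewrite (periodicn (@cosD2pi R)); case: ltrgtP c0 => // [c1|c1] _.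
  by rewrite cosDpi gtr0_norm//; ring.
by rewrite addr0 ltr0_norm// opprK.
Qed.

Lemma curve_point e v : 0 < kappa a b c -> 0 < e -> g (sigma + e) < v * D (sigma + e) ->
  exists2 mu, sigma < mu <= sigma + e & g mu = v * D mu.
Proof.
move=> k0 e0 gv; pose h mu := g mu - v * D mu.
have ch : continuous h.
  by apply: ctsB; [exact: gcurve_continuous|apply: ctsZ; exact: dcurve_continuous].
have Ds : D sigma = 0 by rewrite /dcurve expR_sigma2 ?subrr.
have hs : 0 < h sigma by rewrite /h Ds mulr0 subr0.
have he : h (sigma + e) <= 0 by rewrite /h subr_le0 ltW.
have se : sigma <= sigma + e by lra.
have [mu /andP[sm me] hm] := ivt_zero se ch (ltW hs) he.
exists mu; last by apply/eqP; rewrite -subr_eq0 -/(h mu) hm.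
rewrite me andbT lt_neqAle sm andbT; apply: contraTneq hs => ->.
by rewrite hm ltxx.
Qed.

Let rem_bound := expR (sigma + 1) * (`|sigma| + 1 + `|a|) +
  (`|c| * (`|sigma| + 1) + `|b|).

Let mu_norm mu : sigma < mu -> mu <= sigma + 1 -> `|mu| <= `|sigma| + 1.
Proof.
move=> sm m1; rewrite ler_norml; have := ler_norm sigma.
by have := ler_norm (- sigma); rewrite normrN => ? ?; apply/andP; split; lra.
Qed.

Let coef_le mu : sigma < mu -> mu <= sigma + 1 ->
  `|c * mu + b| <= `|c| * (`|sigma| + 1) + `|b|.
Proof.
move=> sm m1; rewrite (le_trans (ler_normD _ _))// lerD2r normrM ler_wpM2l//.
exact: mu_norm.
Qed.

Let rem_le mu t : sigma < mu -> mu <= sigma + 1 ->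
  `|expR mu * (mu + a) + (c * mu + b) * cos t| <= rem_bound.
Proof.
move=> sm m1; rewrite (le_trans (ler_normD _ _))// lerD//.
  rewrite normrM (ger0_norm (expR_ge0 _)); apply: ler_pM => //.
    by rewrite ler_expR.
  by rewrite (le_trans (ler_normD _ _))// lerD2r mu_norm.
rewrite normrM (le_trans _ (coef_le sm m1))//.
by rewrite ler_piMr// cos_max.
Qed.

(** On the curve the moduli of the two members of [exp lambda * (lambda + a) =
    - (c lambda + b)], rotated by [exp (- i w)], agree. If their real parts agree
    as well then so do their imaginary parts up to sign, and the sign is that of
    [- c cos w], which is positive near [freq n]. *)
Lemma char_root_of_curve n mu w : w ^+ 2 * D mu = g mu ->
  expR mu * (mu + a) + ((c * mu + b) * cos w + c * w * sin w) = 0 ->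
  0 < w -> `|w - freq n| <= 1 -> `|c * mu + b| < expR mu * w ->
  char_root a b c mu w.
Proof.
move=> gE EX w0 wn wbig.
have em : expR (- mu) * expR mu = 1 by rewrite -expRD addNr expR0.
pose X := (c * mu + b) * cos w + c * w * sin w.
pose Y := c * w * cos w - (c * mu + b) * sin w.
have XY : X ^+ 2 + Y ^+ 2 = (c * mu + b) ^+ 2 + (c * w) ^+ 2.
  transitivity (((c * mu + b) ^+ 2 + (c * w) ^+ 2) * (cos w ^+ 2 + sin w ^+ 2)).
    by rewrite /X /Y; ring.
  by rewrite cos2Dsin2 mulr1.
have EY : expR mu * w + Y = 0.
  have : (expR mu * w - Y) * (expR mu * w + Y) = 0.
    move: gE; rewrite /gcurve /dcurve.
    have -> : expR mu * (mu + a) = - X by apply/eqP; rewrite -addr_eq0 EX.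
    by move=> gE; lra.
  move=> /eqP; rewrite mulf_eq0 => /orP[/eqP EYm|/eqP //].
  have YE : - Y = `|c| * w * cos (w - freq n) + (c * mu + b) * sin w.
    have H := c_cos_freq n w; rewrite /Y.
    have -> : c * w * cos w = w * (c * cos w) by ring.
    by rewrite H; ring.
  have cos0' : 0 <= cos (w - freq n).
    move: wn; rewrite ler_norml => wn.
    by apply: cos_ge0_pihalf; have := pi_ge2 R; lra.
  have H1 : 0 <= `|c| * w * cos (w - freq n) by rewrite !mulr_ge0// ltW.
  have : `|(c * mu + b) * sin w| < expR mu * w.
    by rewrite (le_lt_trans _ wbig)// normrM ler_piMr// sin_max.
  rewrite ltr_norml => /andP[H2 _].
  by exfalso; lra.
have back (u V : R) : expR mu * u + V = 0 -> u + expR (- mu) * V = 0.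
  by move=> H; rewrite -[u]mul1r -em -mulrA -mulrDr H mulr0.
by split; apply: back.
Qed.

(** As the frequency runs through a neighbourhood of [freq n] along the curve, the
    difference of the real parts changes sign. *)
Lemma roots_exist e eta : 0 < kappa a b c -> 0 < e <= 1 -> curve_mono a b c e ->
  0 < eta <= 1 ->
  exists n0, forall n, (n0 <= n)%N -> exists mu w,
    [/\ char_root a b c mu w, sigma < mu <= sigma + e & `|w - freq n| <= eta].
Proof.
move=> k0 /andP[e0 e1] mono /andP[eta0 eta1].
pose C1 := rem_bound.
have C10 : 0 <= C1.
  by rewrite /C1 /rem_bound !(addr_ge0, mulr_ge0)// expR_ge0.
pose W1 := g (sigma + e) / D (sigma + e).
have sineta : 0 < sin eta.
  by apply: sin_gt0_pi; have := pi_ge2 R; lra.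
have nc0 : 0 < `|c| by rewrite normr_gt0.
pose Q := C1 / (`|c| * sin eta).
have Q0 : 0 <= Q by rewrite /Q divr_ge0// mulr_ge0// ltW.
exists (Num.truncn (`|W1| + Q + 3)).+1 => n nn.
pose om := freq n.
have omL : `|W1| + Q + 2 <= om - eta.
  have H1 : `|W1| + Q + 3 < (Num.truncn (`|W1| + Q + 3)).+1%:R by exact: truncnS_gt.
  have H2 : (Num.truncn (`|W1| + Q + 3)).+1%:R <= n%:R :> R by rewrite ler_nat.
  by have := freq_ge n; rewrite -/om; lra.
have aW := normr_ge0 W1.
have big r : om - eta <= r -> g (sigma + e) < r ^+ 2 * D (sigma + e).
  move=> rr; have De : 0 < D (sigma + e) by apply: dcurve_gt0; lra.
  have -> : g (sigma + e) = W1 * D (sigma + e) by rewrite /W1 divfK// gt_eqF.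
  rewrite ltr_pM2r// (le_lt_trans (ler_norm W1))//; nra.
have [mup /andP[smp mpe] gp] := curve_point k0 e0 (big (om + eta) (ltac:(lra))).
have [mum /andP[smm mme] gm] := curve_point k0 e0 (big (om - eta) (lexx _)).
have Dp := dcurve_gt0 smp; have Dm := dcurve_gt0 smm.
have vlt : (om - eta) ^+ 2 < (om + eta) ^+ 2 by nra.
have pm : mup <= mum.
  rewrite leNgt; apply/negP => mp.
  have := mono _ _ (ltW smm) mp mpe; rewrite gp gm.
  have -> : (om + eta) ^+ 2 * D mup * D mum = (om + eta) ^+ 2 * (D mum * D mup) by ring.
  by rewrite -[X in _ < X]mulrA ltr_pM2r ?mulr_gt0// ltNge ltW.
have mono' mu nu : sigma < mu -> mu <= nu -> nu <= sigma + e -> g nu * D mu <= g mu * D nu.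
  move=> sm; rewrite le_eqVlt => /orP[/eqP -> //|mn] ne.
  by apply/ltW/mono => //; exact: ltW.
pose W mu := g mu / Num.max (D mu) (D mup).
pose w mu := Num.sqrt (W mu).
have WE mu : mup <= mu <= mum -> g mu = W mu * D mu /\ (om - eta) ^+ 2 <= W mu <= (om + eta) ^+ 2.
  move=> /andP[pmu mum']; have sm : sigma < mu by lra.
  have Dmu := dcurve_gt0 sm.
  have -> : W mu = g mu / D mu by rewrite /W max_l// dcurve_le.
  rewrite divfK ?gt_eqF//; split=> //.
  rewrite ler_pdivlMr// ler_pdivrMr//; apply/andP; split.
    have := mono' _ _ sm mum' mme; rewrite gm mulrAC.
    by rewrite ler_pM2r.
  have := mono' _ _ smp pmu (le_trans mum' mme); rewrite gp.
  by rewrite mulrAC ler_pM2r.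
have om0 : 0 < om - eta by lra.
have w2 mu : mup <= mu <= mum -> w mu ^+ 2 = W mu.
  move=> /WE[_ /andP[H _]]; rewrite sqr_sqrtr//; apply: le_trans H.
  exact: sqr_ge0.
have wE mu : mup <= mu <= mum -> om - eta <= w mu <= om + eta.
  move=> /WE[_ /andP[/ler_wsqrtr H1 /ler_wsqrtr H2]]; move: H1 H2.
  by rewrite !sqrtr_sqr !ger0_norm; [move=> -> ->|lra|lra].
pose F mu := expR mu * (mu + a) + ((c * mu + b) * cos (w mu) + c * w mu * sin (w mu)).
have cid' := @cts_id R.
have cw : continuous w.
  apply: (@cts_comp _ Num.sqrt W); first exact: sqrt_continuous.
  apply: ctsM; first exact: gcurve_continuous.
  move=> mu; apply: cvgV.
    by rewrite gt_eqF// lt_max Dp orbT.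
  have cm : continuous (fun mu => Num.max (D mu) (D mup)).
    by apply: (cts_comp (@cts_max R (D mup))); exact: dcurve_continuous.
  exact: cm.
have ca : continuous (fun mu => mu + a) by apply: ctsD (@cts_cst R a).
have cb : continuous (fun mu => c * mu + b) by apply: ctsD (@cts_cst R b); exact: ctsZ.
have cF : continuous F.
  apply: ctsD; first by apply: ctsM => //; exact: continuous_expR.
  apply: ctsD; apply: ctsM => //.
  - exact: cts_comp (@continuous_cos R) cw.
  - exact: ctsZ.
  - exact: cts_comp (@continuous_sin R) cw.
have FE mu : F mu = (expR mu * (mu + a) + (c * mu + b) * cos (w mu))
    - `|c| * w mu * sin (w mu - om).
  have := c_sin_freq n (w mu); rewrite -/om /F => H.
  have -> : c * w mu * sin (w mu) = w mu * (c * sin (w mu)) by ring.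
  by rewrite H; ring.
have small mu t : sigma < mu -> mu <= sigma + e ->
    `|expR mu * (mu + a) + (c * mu + b) * cos t| <= C1.
  by move=> sm me; apply: rem_le => //; rewrite (le_trans me)// lerD2l.
have Cs : C1 <= `|c| * (om - eta) * sin eta.
  rewrite mulrAC -ler_pdivrMl ?mulr_gt0// mulrC -/Q; lra.
have Cs' : C1 <= `|c| * (om + eta) * sin eta.
  apply: (le_trans Cs); apply: ler_wpM2r; first exact: ltW.
  by apply: ler_wpM2l; [exact: ltW|lra].
have omsq r : 0 <= r -> Num.sqrt (r ^+ 2) = r by move=> ?; rewrite sqrtr_sqr ger0_norm.
have WD mu : mup <= mu -> 0 < D mu -> W mu = g mu / D mu.
  by move=> h1 h2; rewrite /W max_l// dcurve_le.
have wp : w mup = om + eta.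
  by rewrite /w WD// gp mulfK ?gt_eqF// omsq//; lra.
have wm : w mum = om - eta.
  by rewrite /w WD// gm mulfK ?gt_eqF// omsq//; lra.
have Fm : 0 <= F mum.
  rewrite FE wm; have -> : om - eta - om = - eta by ring.
  rewrite sinN; have := small mum (om - eta) smm mme.
  by rewrite ler_norml => /andP[H _]; lra.
have Fp : F mup <= 0.
  rewrite FE wp; have -> : om + eta - om = eta by ring.
  have := small mup (om + eta) smp mpe.
  by rewrite ler_norml => /andP[_ H]; lra.
have [mu mu_itv Fmu] : exists2 mu, mup <= mu <= mum & F mu = 0.
  have cNF : continuous (fun t => - F t) by move=> t; apply: cvgN; exact: cF.
  have [||mu mu_itv /eqP] := ivt_zero pm cNF.
  - by rewrite oppr_ge0.
  - by rewrite oppr_le0.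
  by rewrite oppr_eq0 => /eqP; exists mu.
have /andP[h1 h2] := mu_itv.
have smu : sigma < mu := lt_le_trans smp h1.
have mue : mu <= sigma + e := le_trans h2 mme.
have [gE _] := WE _ mu_itv; rewrite -w2// in gE.
have /andP[w_lo w_hi] := wE _ mu_itv.
exists mu, (w mu); split; [|by rewrite smu|].
  2: by rewrite ler_distl -/om w_lo.
apply: (char_root_of_curve (n := n) (esym gE) Fmu).
- exact: lt_le_trans w_lo.
- by rewrite (le_trans _ eta1)// ler_distl -/om w_lo.
rewrite (le_lt_trans (coef_le smu (le_trans mue _)))//; first by rewrite lerD2l.
apply: (@le_lt_trans _ _ C1).
  rewrite /C1 /rem_bound [X in _ <= X]addrC lerDl mulr_ge0 ?expR_ge0//.
apply: (le_lt_trans Cs).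
apply: (@le_lt_trans _ _ (`|c| * (om - eta))).
  by rewrite ler_piMr ?sin_le1// mulr_ge0// ltW.
rewrite -(expR_sigma c0); apply: (@le_lt_trans _ _ (expR sigma * w mu)).
  by rewrite ler_wpM2l ?expR_ge0.
by rewrite ltr_pM2r ?ltr_expR// (lt_le_trans om0).
Qed.

End roots_near_line.

(** * Fejer means of the sawtooth *)

Section fejer.
Variable R : realType.
Implicit Types (x t r : R) (m : nat).

Definition fejer_coef m i : R := (m%:R - i%:R) / (m.+1%:R * i.+1%:R).

Lemma fejer_kernel_ge0 m x :
  0 <= m.+1%:R + 2 * \sum_(i < m) (m%:R - i%:R) * cos (i.+1%:R * x).
Proof.
suff -> : m.+1%:R + 2 * \sum_(i < m) (m%:R - i%:R) * cos (i.+1%:R * x) =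
    (\sum_(j < m.+1) cos (j%:R * x)) ^+ 2 + (\sum_(j < m.+1) sin (j%:R * x)) ^+ 2.
  by rewrite addr_ge0// sqr_ge0.
elim: m => [|m IH].
  by rewrite !big_ord1 big_ord0 !mul0r cos0 sin0; ring.
rewrite [in RHS]big_ord_recr [X in _ = _ + X ^+ 2]big_ord_recr /=.
set C := \sum_(j < m.+1) cos (j%:R * x); set S := \sum_(j < m.+1) sin _.
have -> : (C + cos (m.+1%:R * x)) ^+ 2 + (S + sin (m.+1%:R * x)) ^+ 2 =
  (C ^+ 2 + S ^+ 2) + 2 * (cos (m.+1%:R * x) * C + sin (m.+1%:R * x) * S)
  + (cos (m.+1%:R * x) ^+ 2 + sin (m.+1%:R * x) ^+ 2) by ring.
rewrite -IH cos2Dsin2.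
have -> : cos (m.+1%:R * x) * C + sin (m.+1%:R * x) * S =
    \sum_(i < m.+1) cos (i.+1%:R * x).
  rewrite /C /S !big_distrr /= -big_split /= (reindex_inj rev_ord_inj) /=.
  apply: eq_bigr => i _; rewrite -cosB subSS; congr cos.
  by rewrite natrB ?leq_ord// -!natr1; ring.
have -> : \sum_(i < m.+1) (m.+1%:R - i%:R) * cos (i.+1%:R * x) =
    \sum_(i < m) (m%:R - i%:R) * cos (i.+1%:R * x) + \sum_(i < m.+1) cos (i.+1%:R * x).
  transitivity (\sum_(i < m.+1) ((m%:R - i%:R) * cos (i.+1%:R * x) + cos (i.+1%:R * x))).
    by apply: eq_bigr => i _; rewrite -[m.+1%:R]natr1; ring.
  by rewrite big_split /= big_ord_recr /= subrr mul0r addr0.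
by rewrite -!natr1; ring.
Qed.

(** The Fejer means of the sawtooth function: twice such a mean plus the identity
    has the nonnegative Fejer kernel as its derivative, hence increases from 0 to
    2 pi on a period. *)
Lemma fejer_sawtooth_le m x : 0 <= x <= pi *+ 2 ->
  `|\sum_(i < m) fejer_coef m i * sin (i.+1%:R * x)| <= pi.
Proof.
move=> /andP[x0 x2].
pose f r := 2 * (\sum_(i < m) fejer_coef m i * sin (i.+1%:R * r)) + r.
pose df r := 2 * (\sum_(i < m) fejer_coef m i * (i.+1%:R * cos (i.+1%:R * r))) + 1.
have dfE r : is_derive r 1 f (df r).
  apply: drvD (drv_id r); apply: drvZ.
  have := @is_derive_sum _ _ _ m (fun i r => fejer_coef m i * sin (i.+1%:R * r)) r 1
    (fun i => fejer_coef m i * (i.+1%:R * cos (i.+1%:R * r))) (fun i => drvZ _ (drv_sinl _ _)).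
  by rewrite fct_sumE.
have df0 r : 0 <= df r.
  have -> : df r = (m.+1%:R)^-1 *
      (m.+1%:R + 2 * \sum_(i < m) (m%:R - i%:R) * cos (i.+1%:R * r)).
    rewrite /df mulrDr mulVf ?pnatr_eq0// addrC mulrCA; congr (_ + 2 * _).
    rewrite big_distrr; apply: eq_bigr => i _ /=; rewrite /fejer_coef.
    by field; rewrite !nat1r !pnatr_eq0.
  by rewrite mulr_ge0 ?invr_ge0 ?ler0n// fejer_kernel_ge0.
have cf : continuous f by move=> r; exact: drv_cont (dfE r).
have fle u v : u <= v -> f u <= f v.
  move=> uv; have [r _ E] := MVT_segment uv (fun r _ => dfE r) (continuous_subspaceT cf).
  by rewrite -subr_ge0 E mulr_ge0// subr_ge0.
have f0 : f 0 = 0.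
  by rewrite /f big1 ?mulr0 ?addr0// => i _; rewrite mulr0 sin0 mulr0.
have f2 : f (pi *+ 2) = pi *+ 2.
  rewrite /f big1 ?mulr0 ?add0r// => i _.
  rewrite mulr_natl -[_ *+ i.+1]add0r (periodicn (@sinD2pi R)) sin0 mulr0//.
have := fle _ _ x0; have := fle _ _ x2; rewrite f0 f2 /f => H1 H2.
by rewrite ler_norml; apply/andP; split; lra.
Qed.

Lemma fejer_coef_ge0 m i : (i < m)%N -> 0 <= fejer_coef m i.
Proof.
by move=> im; rewrite divr_ge0// ?subr_ge0 ?ler_nat 1?ltnW// mulr_ge0.
Qed.

Lemma fejer_coef_unbounded (k : R) : exists m, k < \sum_(i < m) fejer_coef m i.
Proof.
apply: contrapT => H.
apply: (@dvg_harmonic R); apply: nondecreasing_is_cvgn.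
  by apply/nondecreasing_seqP => n; rewrite seriesSr lerDl; exact: harmonic_ge0.
exists (k + 1) => _ [m _ <-].
have /negP : ~ k < \sum_(i < m) fejer_coef m i by move=> ?; apply: H; exists m.
rewrite -leNgt => km.
have E : \sum_(i < m) fejer_coef m i = series harmonic m - m.+1%:R^-1 *+ m.
  rewrite seriesEord /= -[X in _ *+ X](card_ord m) -sumr_const -sumrB.
  apply: eq_bigr => i _; rewrite /fejer_coef /harmonic -!natr1.
  by field; rewrite !natr1 !pnatr_eq0.
have : m.+1%:R^-1 *+ m <= 1 :> R.
  by rewrite -[_ *+ m]mulr_natl ler_pdivrMr ?ltr0n// mul1r ler_nat.
by move: km; rewrite E lerBlDr => km H1; rewrite (le_trans km)// lerD2l.
Qed.

End fejer.

(** * Gaps to the right of the limit line *)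

Section modes_close.
Variable R : realType.
Implicit Types (x y t r mu nu w v : R).

Lemma lipschitz_of_derive (f df : R -> R) r (k : R) :
  (forall t, is_derive t 1 f (df t)) -> (forall t, r <= t -> `|df t| <= k) ->
  forall x y, r <= x -> r <= y -> `|f x - f y| <= k * `|x - y|.
Proof.
move=> dfE dfk; have cf : continuous f by move=> t; exact: drv_cont (dfE t).
suff H x y : r <= y -> y <= x -> `|f x - f y| <= k * `|x - y|.
  move=> x y rx ry; have [yx|/ltW xy] := leP y x; first exact: H.
  by rewrite distrC [`|x - y|]distrC; exact: H.
move=> ry yx; rewrite [`|x - y|]ger0_norm ?subr_ge0//.
apply: (mean_value_bound yx cf (fun t _ => dfE t)) => t /andP[yt _].
by apply: dfk; exact: le_trans yt.
Qed.

Lemma cosmode_close r mu nu w v t : r <= mu -> r <= nu -> -1 <= t <= 0 ->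
  `|cosmode mu w t - cosmode nu v t| <= expR `|r| * (`|mu - nu| + `|w - v|).
Proof.
move=> rm rn /andP[t1 t0].
have ub s : r <= s -> expR (t * s) <= expR `|r|.
  move=> rs; rewrite ler_expR; have := ler_norm (- r); have := normr_ge0 r.
  by rewrite normrN; nra.
have H1 : `|expR (t * mu) - expR (t * nu)| <= expR `|r| * `|mu - nu|.
  apply: (lipschitz_of_derive (drv_expl t) _ rm rn) => s rs.
  rewrite normrM (ger0_norm (expR_ge0 _)) -[X in _ <= X]mul1r ler_pM ?expR_ge0//.
    by rewrite ler_norml; apply/andP; split; lra.
  exact: ub.
have H2 : `|cos (t * w) - cos (t * v)| <= 1 * `|w - v|.
  apply: (lipschitz_of_derive (r := Num.min w v) (drv_cosl t)).
  - move=> s _; rewrite normrM -[X in _ <= X]mulr1 ler_pM ?sin_max//.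
    by rewrite ler_norml; apply/andP; split; lra.
  - by rewrite ge_min lexx.
  - by rewrite ge_min lexx orbT.
rewrite /cosmode ![_ * t]mulrC.
have -> : expR (t * mu) * cos (t * w) - expR (t * nu) * cos (t * v) =
  (expR (t * mu) - expR (t * nu)) * cos (t * w) +
  expR (t * nu) * (cos (t * w) - cos (t * v)) by ring.
rewrite (le_trans (ler_normD _ _))// [X in _ <= X]mulrDr lerD// normrM.
  by rewrite (le_trans _ H1)// ler_piMr// cos_max.
rewrite (ger0_norm (expR_ge0 _)) ler_pM ?expR_ge0//; first exact: ub.
by move: H2; rewrite mul1r.
Qed.

Lemma C10_subE (phi psi : C10 R) theta :
  C10_fun (phi - psi) theta = phi theta - psi theta.
Proof. by []. Qed.

Lemma C10_sumE n (k : 'I_n -> R) (phi : 'I_n -> C10 R) theta :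
  (\sum_i k i *: phi i) theta = \sum_i k i * phi i theta.
Proof.
elim: n k phi => [|n IH] k phi; first by rewrite !big_ord0.
by rewrite !big_ord_recl C10_addE IH.
Qed.

Lemma linear_sum (P : C10 R -> C10 R) n (k : 'I_n -> R) (phi : 'I_n -> C10 R) :
  linear P -> P (\sum_i k i *: phi i) = \sum_i k i *: P (phi i).
Proof.
move=> lP; have P0 : P 0 = 0.
  by have := lP (-1) 0 0; rewrite scaler0 addr0 scaleN1r addNr.
elim: n k phi => [|n IH] k phi; first by rewrite !big_ord0.
by rewrite !big_ord_recl lP IH.
Qed.

End modes_close.

Section right_gaps.
Variable R : realType.
Variables (a b c : R) (P : nat -> C10 R -> C10 R) (beta alpha : nat -> R) (M : R).
Hypothesis c0 : c != 0.
Hypothesis M0 : 0 <= M.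
Hypothesis sP : forall m, splits a b c (P m) (beta m) (alpha m).
Hypothesis P_inj : injective P.
Hypothesis PM : forall m phi, `|P m phi| <= M * `|phi|.
Variable G : set nat.
Hypothesis infG : infinite_set G.
Hypothesis Gright : forall m, G m -> sigma c <= beta m.
Implicit Types (mu nu w v t r : R).

Local Notation sigma := (sigma c).

Let beta_lt m : beta m < alpha m.
Proof. by case: (sP m). Qed.

Let alpha_gt m : G m -> sigma < alpha m.
Proof. by move=> /Gright h; exact: le_lt_trans (beta_lt m). Qed.

Let mode mu w : C10 R := restr (cosmode mu w).

Let modeE mu w theta : mode mu w theta = cosmode mu w (\val theta).
Proof. by rewrite restrE//; exact: cosmode_continuous. Qed.

Let E := expR `|sigma|.

(** A gap between two characteristic exponents keeps the corresponding solutions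
    apart, as the projection kills one and fixes the other. *)
Lemma separated_roots m mu w nu v : char_root a b c mu w -> char_root a b c nu v ->
  sigma <= mu -> sigma <= nu -> alpha m <= mu -> nu <= beta m ->
  1 <= M * (E * (`|mu - nu| + `|w - v|)).
Proof.
move=> rmu rnu sm sn am nb.
have H1 := splits_cosmode_unstable c0 (sP m) rmu (lt_le_trans (beta_lt m) am).
have H2 := splits_cosmode_stable c0 (sP m) rnu (le_lt_trans nb (beta_lt m)).
have [_ lP _ _] := sP m.
have Pd : P m (mode mu w - mode nu v) = mode mu w.
  by rewrite addrC -scaleN1r lP H1 H2 scaler0 add0r.
have one : 1 <= `|mode mu w|.
  apply: le_trans (le_norm_C10 _ (delay0 R)).
  by rewrite modeE /cosmode /= !mulr0 expR0 cos0 mulr1 normr1.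
apply: (le_trans one); rewrite -{1}Pd (le_trans (PM _ _))// ler_wpM2l//.
apply: norm_le_C10 => theta.
rewrite C10_subE !modeE.
by apply: cosmode_close => //; exact: delay_itv.
Qed.

Definition right_root mu w :=
  char_root a b c mu w /\ exists2 m, G m & alpha m <= mu.

Let right_root_gt mu w : right_root mu w -> sigma < mu.
Proof. by move=> [_ [m Gm am]]; exact: lt_le_trans (alpha_gt Gm) am. Qed.

Let separated m n : G m -> G n -> m <> n ->
  alpha m <= beta n \/ alpha n <= beta m.
Proof.
move=> Gm Gn mn; have [|h1] := leP (alpha m) (beta n); first by left.
have [|h2] := leP (alpha n) (beta m); first by right.
by exfalso; apply/mn/P_inj; exact: splits_overlap c0 (sP m) (sP n) h2 h1.
Qed.

Let root_right m n : G m -> G n -> m <> n -> alpha m <= beta n ->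
  exists mu w, right_root mu w /\ alpha m <= mu <= beta n.
Proof.
move=> Gm Gn mn ab; have Pmn : P m <> P n by move=> /P_inj.
have [mu [w [rt /andP[am bn]]]] :=
  root_between c0 (sP m) (sP n) Pmn ab (alpha_gt Gm).
by exists mu, w; split; [split=> //; exists m|rewrite am].
Qed.

(** If the roots between the gaps stayed in a bounded region, cut it into cells
    too small to contain two separated roots; the set of cells that contain a
    root to the left of a gap would then determine the gap, against the
    infinity of the gaps. *)
Lemma right_roots_unbounded (X : R) : exists mu w, right_root mu w /\ X < `|w|.
Proof.
apply: contrapT => H.
have wX mu w : right_root mu w -> `|w| <= X.
  by move=> rt; rewrite leNgt; apply/negP => ?; apply: H; exists mu, w.
pose ME := M * E.
have ME0 : 0 <= ME by rewrite mulr_ge0// expR_ge0.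
(* two roots in one cell of side d violate the separation estimate *)
pose d := (2 * (ME + 1))^-1.
have d0 : 0 < d by rewrite invr_gt0 mulr_gt0// ltr_pwDr.
have dME : ME * (d + d) < 1.
  have -> : ME * (d + d) = ME / (ME + 1) by rewrite /d; field; lra.
  by rewrite ltr_pdivrMr ?ltr_pwDr// mul1r ltrDl.
clearbody d; pose cell mu w := (Num.truncn ((mu - sigma) / d), Num.truncn ((w + X) / d)).
pose n := (Num.truncn ((mu_max a b c - sigma) / d) + Num.truncn ((X + X) / d))%N.
have truncn_mono (x y : R) : x <= y -> (Num.truncn x <= Num.truncn y)%N.
  by move=> xy; exact: le_truncn.
have close (x y : R) : 0 <= x -> 0 <= y -> Num.truncn (x / d) = Num.truncn (y / d) ->
    `|x - y| < d.
  move=> x0 y0 xy.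
  have /andP[x1 x2] := truncn_itv (divr_ge0 x0 (ltW d0)).
  have /andP[y1 y2] := truncn_itv (divr_ge0 y0 (ltW d0)).
  rewrite xy in x1 x2.
  move: x1 x2 y1 y2; rewrite -natr1 !ler_pdivlMr// !ltr_pdivrMr// => x1 x2 y1 y2.
  by rewrite ltr_norml; apply/andP; split; lra.
pose f (m : nat) : {set 'I_n.+1 * 'I_n.+1} := [set q : 'I_n.+1 * 'I_n.+1 | `[< exists mu w,
  [/\ right_root mu w, mu <= beta m & cell mu w = (q.1 : nat, q.2 : nat)] >]]%SET.
have f_neq m k : G m -> G k -> m <> k -> alpha m <= beta k -> f m <> f k.
  move=> Gm Gk mk ab fmk.
  have [mu [w [rt /andP[am bk]]]] := root_right Gm Gk mk ab.
  have smu := right_root_gt rt.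
  have mun : (Num.truncn ((mu - sigma) / d) < n.+1)%N.
    rewrite ltnS (leq_trans _ (leq_addr _ _))// truncn_mono//.
    by rewrite ler_pM2r ?invr_gt0// lerD2r; exact: (char_root_le_max rt.1).
  have wn : (Num.truncn ((w + X) / d) < n.+1)%N.
    rewrite ltnS (leq_trans _ (leq_addl _ _))// truncn_mono//.
    by rewrite ler_pM2r ?invr_gt0// lerD2r (le_trans (ler_norm _))// (wX mu w).
  have : (Ordinal mun, Ordinal wn) \in f k.
    by rewrite inE; apply/asboolP; exists mu, w.
  rewrite -fmk inE => /asboolP[nu [v [rt' nub [e1 e2]]]].
  have snu := right_root_gt rt'.
  have := separated_roots rt.1 rt'.1 (ltW smu) (ltW snu) am nub.
  have H1 : `|mu - nu| < d.
    have -> : mu - nu = (mu - sigma) - (nu - sigma) by ring.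
    by apply: close; rewrite ?subr_ge0 ?ltW.
  have H2 : `|w - v| < d.
    have := wX _ _ rt; have := wX _ _ rt'; rewrite !ler_norml => /andP[v1 v2] /andP[w1 w2].
    have -> : w - v = (w + X) - (v + X) by ring.
    by apply: close; rewrite ?e2//; lra.
  rewrite mulrA -/ME leNgt => /negP; apply.
  by rewrite (le_lt_trans _ dME)// ler_wpM2l// lerD// ltW.
have f_inj : {in G &, injective f}.
  move=> m k /set_mem Gm /set_mem Gk fmk; apply: contrapT => mk.
  have [ab|ab] := separated Gm Gk mk; first exact: (f_neq m k).
  by apply: (f_neq k m) => // /esym.
apply: infG; rewrite -(eq_finite_set (inj_card_eq f_inj)).
exact: sub_finite_set (@subsetT _ _) (@finite_finset _ _).
Qed.

Local Notation kappa := (kappa a b c).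
Local Notation slope := (slope a b c).

Let c2 := c2_gt0 c0.

Let sqr_gt (X w : R) : 1 <= X -> X < `|w| -> X < w ^+ 2.
Proof.
move=> X1 Xw; rewrite -[w ^+ 2]real_normK ?num_real// (lt_le_trans Xw)//.
by rewrite expr2 ler_peMl//; lra.
Qed.

(** Otherwise both [gcurve mu] and [dcurve mu] are controlled by [mu - sigma], which
    bounds [w] on the curve. *)
Lemma kappa_gt0 : 0 < kappa.
Proof.
rewrite ltNge; apply/negP => k0.
(* on the curve [w ^+ 2 * (2 * c ^+ 2)] would be at most [slope] *)
pose X := 1 + `|slope| / (2 * c ^+ 2).
have [mu [w [rt wX]]] := right_roots_unbounded X.
have smu := right_root_gt rt.
have H1 := char_root_curve rt.1.
have H2 := dcurve_ge c0 (ltW smu).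
have H3 := gcurve_le a b c0 (ltW smu).
have X1 : 1 <= X by rewrite /X lerDl divr_ge0// mulr_ge0// ltW.
have w2 := sqr_gt X1 wX.
have H4 : w ^+ 2 * (2 * c ^+ 2 * (mu - sigma)) <= slope * (mu - sigma).
  by rewrite (le_trans (ler_wpM2l (sqr_ge0 w) H2))// H1; lra.
have H5 : w ^+ 2 * (2 * c ^+ 2) <= slope.
  by rewrite -(ler_pM2r (_ : 0 < mu - sigma)) ?subr_gt0// -mulrA.
have H6 : X * (2 * c ^+ 2) < w ^+ 2 * (2 * c ^+ 2) by rewrite ltr_pM2r// mulr_gt0.
have H7 : X * (2 * c ^+ 2) = 2 * c ^+ 2 + `|slope|.
  by rewrite /X; field; rewrite ?c0.
by have := ler_norm slope; have := c2; lra.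
Qed.

(** On the curve a large [w] forces [mu] to be close to [sigma]. *)
Lemma gap_near e : 0 < e -> exists2 m, G m & alpha m < sigma + e.
Proof.
move=> e0.
pose Y := kappa + `|slope| * `|mu_max a b c - sigma|.
have Y0 : 0 <= Y by rewrite addr_ge0 ?(ltW kappa_gt0)// mulr_ge0.
pose X := 1 + Y / (2 * c ^+ 2 * e).
have ce : 0 < 2 * c ^+ 2 * e by rewrite mulr_gt0// mulr_gt0.
have [mu [w [rt wX]]] := right_roots_unbounded X.
have smu := right_root_gt rt.
have [_ [m Gm am]] := rt; exists m => //.
apply: (le_lt_trans am); rewrite ltNge; apply/negP => emu.
have H1 := char_root_curve rt.1.
have H2 := dcurve_ge c0 (ltW smu).
have H3 := gcurve_le a b c0 (ltW smu).
have mum := char_root_le_max rt.1.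
have X1 : 1 <= X by rewrite /X lerDl divr_ge0// ltW.
have w2 := sqr_gt X1 wX.
have H4 : slope * (mu - sigma) <= `|slope| * `|mu_max a b c - sigma|.
  rewrite (le_trans (ler_norm _))// normrM ler_wpM2l// ler_norml.
  by have := ler_norm (mu_max a b c - sigma); move=> ?; apply/andP; split; lra.
have H5 : 2 * c ^+ 2 * e <= dcurve c mu.
  apply: le_trans H2; apply: ler_wpM2l; last by lra.
  by rewrite mulr_ge0// ltW.
have H6 : w ^+ 2 * (2 * c ^+ 2 * e) <= Y.
  by rewrite (le_trans (ler_wpM2l (sqr_ge0 w) H5))// H1 /Y; lra.
have H7 : X * (2 * c ^+ 2 * e) < w ^+ 2 * (2 * c ^+ 2 * e) by rewrite ltr_pM2r.
have H8 : X * (2 * c ^+ 2 * e) = 2 * c ^+ 2 * e + Y.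
  by rewrite /X; field; rewrite ?c0 ?gt_eqF.
lra.
Qed.

Let small_step (q : R) : 0 <= q ->
  exists2 eta, 0 < eta <= 1 & 4 * (q * eta) <= 1 / 2.
Proof.
move=> q0; have d0 : 0 < 8 * q + 1 by lra.
exists (8 * q + 1)^-1; first by rewrite invr_gt0 d0 invf_le1//; lra.
have -> : 4 * (q / (8 * q + 1)) = 4 * q / (8 * q + 1) by ring.
by rewrite ler_pdivrMr//; lra.
Qed.

(** The unstable projection of a gap close to [sigma] keeps the modes of index at
    most [N] and kills the later ones. Let it act on the sum over [k] of
    [(mode (N - k) - mode (N + k)) / k], with Fejer weights. For exact frequencies on
    the line [Re lambda = sigma] this is a bounded factor times a mean of the
    sawtooth, hence bounded; the deviation of the true modes costs at most a small multiple of the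
    harmonic sum. The half that is kept takes at 0 the value of the whole harmonic
    sum. *)
Lemma right_gaps_absurd : False.
Proof.
have k0 := kappa_gt0.
have [e' e'0 mono'] := curve_monoP c0 k0.
have E0 : 0 < E by exact: expR_gt0.
have ME : 0 <= M * E by rewrite mulr_ge0// expR_ge0.
have [eta /andP[eta0 eta1] etaM] := small_step ME.
pose e := Num.min e' eta.
have e0 : 0 < e by rewrite lt_min e'0.
have ee : e <= eta by rewrite ge_min lexx orbT.
have mono : curve_mono a b c e.
  move=> mu nu sm mn nue; apply: mono' => //; apply: (le_trans nue).
  by rewrite lerD2l ge_min lexx.
have e1 : 0 < e <= 1 by rewrite e0 (le_trans ee).
have eta01 : 0 < eta <= 1 by rewrite eta0.
have [n0 n0P] := roots_exist c0 k0 e1 mono eta01.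
have /choice[r rP] : forall n, exists r : R * R, (n0 <= n)%N ->
    [/\ char_root a b c r.1 r.2, sigma < r.1 <= sigma + e & `|r.2 - freq c n| <= eta].
  move=> n; have [nn|nn] := leqP n0 n; last by exists (0, 0).
  by have [mu [w H]] := n0P n nn; exists (mu, w).
pose mu n := (r n).1; pose w n := (r n).2.
have rt n : (n0 <= n)%N -> char_root a b c (mu n) (w n) by move=> /rP[].
have mu_gt n : (n0 <= n)%N -> sigma < mu n by move=> /rP[_ /andP[]].
have mu_le n : (n0 <= n)%N -> mu n <= sigma + e by move=> /rP[_ /andP[]].
have wf n : (n0 <= n)%N -> `|w n - freq c n| <= eta by move=> /rP[].
have wge n : (n0 <= n)%N -> n%:R - 1 <= w n.
  move=> nn; have := wf n nn; have := freq_ge c n.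
  by rewrite ler_norml => ? /andP[? _]; lra.
have D_gt0 n : (n0 <= n)%N -> 0 < dcurve c (mu n).
  by move=> nn; apply: dcurve_gt0 => //; exact: mu_gt.
(* the curve is decreasing and the frequencies increase *)
have mu_dec n k : (n0 <= n)%N -> (n < k)%N -> mu k < mu n.
  move=> nn nk; have kn : (n0 <= k)%N := leq_trans nn (ltnW nk).
  have fnk : freq c n + 4 <= freq c k.
    rewrite -(subnKC nk) addSnnS freqS lerD2l.
    have := pi_ge2 R; have := pi_ge0 R => p0 p2.
    rewrite -[pi *+ 2 *+ _]mulr_natr (@le_trans _ _ ((pi *+ 2) * 1))//; first by rewrite mulr1 mulr2n; lra.
    by apply: ler_wpM2l; [rewrite mulrn_wge0|rewrite ler1n].
  have wnk : `|w n| < w k.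
    have := wf n nn; have := wf k kn; have := freq_ge c n; have := ler0n R n.
    rewrite !ler_norml => ? ? /andP[? ?] /andP[? ?].
    by rewrite ltr_norml; apply/andP; split; lra.
  have w2 : w n ^+ 2 < w k ^+ 2.
    have wk0 : 0 <= w k := le_trans (normr_ge0 _) (ltW wnk).
    by rewrite -[w n ^+ 2]real_normK ?num_real// ltrXn2r ?nnegrE.
  rewrite ltNge; apply/negP => le_mu.
  have gn := char_root_curve (rt n nn); have gk := char_root_curve (rt k kn).
  have : gcurve a b c (mu k) * dcurve c (mu n) <= gcurve a b c (mu n) * dcurve c (mu k).
    move: le_mu; rewrite le_eqVlt => /orP[/eqP -> //|lt_mu].
    exact/ltW/(mono _ _ (ltW (mu_gt _ nn)) lt_mu (mu_le _ kn)).
  have DD : 0 < dcurve c (mu n) * dcurve c (mu k) by rewrite mulr_gt0// D_gt0.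
  by have := w2; rewrite -(ltr_pM2r DD) -gn -gk; lra.
have mu_below al : sigma < al -> exists n1, forall n, (n0 <= n)%N -> (n1 <= n)%N ->
    mu n < al.
  move=> sal.
  pose Y := kappa + `|slope| * `|mu_max a b c - sigma|.
  have ca : 0 < 2 * c ^+ 2 * (al - sigma) by rewrite mulr_gt0 ?subr_gt0// mulr_gt0.
  pose Z := Y / (2 * c ^+ 2 * (al - sigma)).
  exists (Num.truncn (`|Z| + 2)).+1 => n nn n1n.
  rewrite ltNge; apply/negP => almu.
  have Z1 : `|Z| + 2 < n%:R.
    apply: (lt_le_trans (truncnS_gt _)); by rewrite ler_nat.
  have smu := mu_gt n nn.
  have H1 := char_root_curve (rt n nn).
  have H2 := dcurve_ge c0 (ltW smu).
  have H3 := gcurve_le a b c0 (ltW smu).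
  have mum := char_root_le_max (rt n nn).
  have H4 : slope * (mu n - sigma) <= `|slope| * `|mu_max a b c - sigma|.
    rewrite (le_trans (ler_norm _))// normrM ler_wpM2l// ler_norml.
    by have := ler_norm (mu_max a b c - sigma); move=> ?; apply/andP; split; lra.
  have H5 : 2 * c ^+ 2 * (al - sigma) <= dcurve c (mu n).
    apply: le_trans H2; apply: ler_wpM2l; last by lra.
    by rewrite mulr_ge0// ltW.
  have H6 : w n ^+ 2 * (2 * c ^+ 2 * (al - sigma)) <= Y.
    by rewrite (le_trans (ler_wpM2l (sqr_ge0 (w n)) H5))// H1 /Y; lra.
  have {}H6 : w n ^+ 2 <= Z by rewrite /Z ler_pdivlMr.
  have Z0 := normr_ge0 Z; have Zn := ler_norm Z.
  have w1 : `|Z| + 1 < w n by have := wge n nn; lra.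
  by nra.
(* the number of modes is fixed first, the gap is then taken so close to sigma that
   at least m good modes lie above it *)
have [m mQ] := fejer_coef_unbounded (4 * M * (E * (pi *+ 2))).
pose Q := \sum_(i < m) fejer_coef R m i.
have mu1 : 0 < mu (n0 + m)%N - sigma by rewrite subr_gt0 mu_gt// leq_addr.
have [A GA alA] := gap_near mu1.
have {}alA : alpha A < mu (n0 + m)%N by lra.
pose above n := (n0 <= n)%N && (alpha A <= mu n).
have above1 : exists n, above n.
  by exists (n0 + m)%N; rewrite /above leq_addr ltW.
have [n1 n1P] := mu_below _ (alpha_gt GA).
have aboveB n : above n -> (n <= n1)%N.
  move=> /andP[nn al]; rewrite leqNgt; apply/negP => n1n.
  by have := n1P n nn (ltnW n1n); rewrite ltNge al.
pose N := ex_maxn above1 aboveB.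
have [aboveN maxN] : above N /\ forall n, above n -> (n <= N)%N.
  by rewrite /N; case: ex_maxnP.
have nmN : (n0 + m <= N)%N by apply: maxN; rewrite /above leq_addr ltW.
have [n0N alN] := andP aboveN.
pose md n := mode (mu n) (w n).
have leN (i : 'I_m) : (n0 <= N - i.+1)%N.
  by have := leq_sub nmN (ltn_ord i); rewrite addnK.
have Nle (i : 'I_m) : (n0 <= N + i.+1)%N := leq_trans n0N (leq_addr _ _).
have ltN (i : 'I_m) : (N < N + i.+1)%N by rewrite addnS ltnS leq_addr.
have lowN n : (n0 <= n)%N -> (n <= N)%N -> P A (md n) = md n.
  move=> nn nN; apply: splits_cosmode_unstable c0 (sP A) (rt n nn) _.
  apply: (lt_le_trans (beta_lt A)); apply: (le_trans alN).
  move: nN; rewrite leq_eqVlt => /orP[/eqP -> //|nN].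
  exact/ltW/mu_dec.
have highN n : (N < n)%N -> P A (md n) = 0.
  move=> Nn; have nn : (n0 <= n)%N by exact: leq_trans (ltnW Nn).
  apply: splits_cosmode_stable c0 (sP A) (rt n nn) _.
  rewrite ltNge; apply/negP => al.
  by have := maxN n; rewrite /above nn al => /(_ isT); rewrite leqNgt Nn.
pose f := \sum_(i < m) fejer_coef R m i *: (md (N - i.+1)%N - md (N + i.+1)%N).
have [_ lP _ _] := sP A.
have Pf : P A f = \sum_(i < m) fejer_coef R m i *: md (N - i.+1)%N.
  rewrite /f linear_sum//; apply: eq_bigr => i _; congr (_ *: _).
  by rewrite addrC -scaleN1r lP highN// lowN ?leq_subr// scaler0 add0r.
have Q0 : 0 <= Q by apply: sumr_ge0 => i _; exact: fejer_coef_ge0.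
have Q_le : Q <= `|P A f|.
  apply: le_trans (le_norm_C10 _ (delay0 R)); rewrite Pf C10_sumE.
  apply: le_trans (ler_norm _); rewrite le_eqVlt; apply/orP; left; apply/eqP.
  apply: eq_bigr => i _; rewrite modeE /cosmode /= !mulr0 expR0 cos0 !mulr1.
  by [].
pose lim n t := expR (sigma * t) * cos (freq c n * t).
have close n t : (n0 <= n)%N -> -1 <= t <= 0 ->
    `|cosmode (mu n) (w n) t - lim n t| <= 2 * (E * eta).
  move=> nn t10; have smu := mu_gt n nn; have mue := mu_le n nn.
  have := cosmode_close (w n) (freq c n) (ltW smu) (lexx sigma) t10.
  rewrite -[cosmode sigma _ _]/(lim n t) => /le_trans; apply.
  have -> : 2 * (E * eta) = E * (eta + eta) by ring.
  apply: ler_wpM2l; first exact: ltW.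
  rewrite lerD ?wf// ger0_norm; last by rewrite subr_ge0 ltW.
  by rewrite lerBlDl (le_trans mue)// lerD2l.
have fle : `|f| <= E * (pi *+ 2) + 4 * (E * eta) * Q.
  apply: norm_le_C10 => theta; rewrite /f C10_sumE.
  have th := delay_itv theta; have /andP[th1 th0] := th.
  set t := \val theta in th th1 th0.
  have -> : \sum_(i < m) fejer_coef R m i * C10_fun (md (N - i.+1)%N - md (N + i.+1)%N) theta
     = \sum_(i < m) fejer_coef R m i * (lim (N - i.+1)%N t - lim (N + i.+1)%N t)
     + \sum_(i < m) fejer_coef R m i *
        ((cosmode (mu (N - i.+1)%N) (w (N - i.+1)%N) t - lim (N - i.+1)%N t) -
         (cosmode (mu (N + i.+1)%N) (w (N + i.+1)%N) t - lim (N + i.+1)%N t)).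
    rewrite -big_split; apply: eq_bigr => i _; rewrite C10_subE !modeE -/t /=.
    by ring.
  rewrite (le_trans (ler_normD _ _))// lerD//.
    have -> : \sum_(i < m) fejer_coef R m i * (lim (N - i.+1)%N t - lim (N + i.+1)%N t)
      = - (2 * expR (sigma * t) * sin (freq c N * t)) *
        \sum_(i < m) fejer_coef R m i * sin (i.+1%:R * (- (pi *+ 2) * t)).
      rewrite big_distrr /=; apply: eq_bigr => i _.
      have -> : lim (N - i.+1)%N t = expR (sigma * t) *
          cos (freq c N * t + i.+1%:R * (- (pi *+ 2) * t)).
        rewrite /lim; congr (_ * cos _).
        have iN := leq_trans (ltn_ord i) (leq_trans (leq_addl n0 m) nmN).
        have := freqS c (N - i.+1) i.+1; rewrite subnK// => ->.
        by rewrite -mulr_natr; ring.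
      have -> : lim (N + i.+1)%N t = expR (sigma * t) *
          cos (freq c N * t - i.+1%:R * (- (pi *+ 2) * t)).
        rewrite /lim; congr (_ * cos _).
        by rewrite freqS -mulr_natr; ring.
      by rewrite cosD cosB; ring.
    rewrite normrM normrN !normrM (ger0_norm (expR_ge0 _)) ger0_norm//.
    have H1 : `|\sum_(i < m) fejer_coef R m i * sin (i.+1%:R * (- (pi *+ 2) * t))| <= pi.
      have p2 := pi_ge0 R.
      by apply: fejer_sawtooth_le; rewrite mulr2n; apply/andP; split; nra.
    have H2 : expR (sigma * t) <= E.
      rewrite /E ler_expR; have := ler_norm (- sigma); have := normr_ge0 sigma.
      by rewrite normrN; nra.
    have H3 : expR (sigma * t) * `|sin (freq c N * t)| <= E.
      by rewrite (le_trans _ H2)// ler_piMr ?expR_ge0// sin_max.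
    have H4 := ler_pM (mulr_ge0 (expR_ge0 _) (normr_ge0 _)) (normr_ge0 _) H3 H1.
    by rewrite -[2 * _ * _]mulrA -mulrA mulr2n; lra.
  rewrite (le_trans (ler_norm_sum _ _ _))// /Q big_distrr /=.
  apply: ler_sum => i _; have q0 := fejer_coef_ge0 R (ltn_ord i).
  rewrite normrM (ger0_norm q0) mulrC ler_wpM2r//.
  rewrite (le_trans (ler_normB _ _))//.
  have H1 := close _ t (leN i) th.
  have H2 := close _ t (Nle i) th.
  by lra.
have := le_trans Q_le (le_trans (PM A f) (ler_wpM2l M0 fle)).
have -> : M * (E * (pi *+ 2) + 4 * (E * eta) * Q) =
  M * (E * (pi *+ 2)) + 4 * (M * E * eta) * Q by ring.
have := ler_wpM2r Q0 etaM.
have : 4 * M * (E * (pi *+ 2)) < Q by exact: mQ.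
have -> : 4 * M * (E * (pi *+ 2)) = 4 * (M * (E * (pi *+ 2))) by ring.
have : 0 <= M * (E * (pi *+ 2)) by rewrite mulr_ge0// mulr_ge0 ?expR_ge0// mulrn_wge0// pi_ge0.
move: (M * (E * (pi *+ 2))) (4 * (M * E * eta) * Q) => u v *.
lra.
Qed.

End right_gaps.

(** * Reversal of time *)

Section reversal.
Variable R : realType.
Implicit Types (a b c s t k : R) (phi psi : C10 R) (P : C10 R -> C10 R)
  (theta : delay R).

Let rev_itv theta : -1 <= -1 - \val theta <= 0.
Proof. by have /andP[? ?] := delay_itv theta; apply/andP; split; lra. Qed.

Definition rev_pt theta : delay R := delay_pt (rev_itv theta).

Lemma rev_ptK : involutive rev_pt.
Proof. by move=> theta; apply: val_inj; rewrite /=; ring. Qed.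

Definition reverse phi : C10 R := get [set psi : C10 R | forall theta, psi theta = phi (rev_pt theta)].

Lemma revE phi theta : reverse phi theta = phi (rev_pt theta).
Proof.
have [x cx xphi] := C10_extension phi.
have : [set psi : C10 R | forall theta, psi theta = phi (rev_pt theta)] !=set0.
  exists (restr (fun t => x (-1 - t))) => th.
  have cr : continuous (fun t => x (-1 - t)) by exact: cts_refl.
  by rewrite restrE// -xphi.
by move=> /getPex; apply.
Qed.

Lemma revK : involutive reverse.
Proof. by move=> phi; apply: C10_ext => theta; rewrite !revE rev_ptK. Qed.

Lemma rev_lin k phi psi : reverse (k *: phi + psi) = k *: reverse phi + reverse psi.
Proof. by apply: C10_ext => theta; rewrite !(revE, C10_addE, C10_scaleE). Qed.

Lemma revB phi psi : reverse (phi - psi) = reverse phi - reverse psi.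
Proof. by rewrite addrC -scaleN1r rev_lin scaleN1r addrC. Qed.

Lemma norm_rev phi : `|reverse phi| = `|phi|.
Proof.
have H psi : `|reverse psi| <= `|psi|.
  by apply: norm_le_C10 => theta; rewrite revE le_norm_C10.
by apply/eqP; rewrite eq_le H -{1}(revK phi) H.
Qed.

Lemma flow_rev a b c t phi : c != 0 ->
  flow (- (b / c)) (- (a / c)) c^-1 t (reverse phi) = reverse (flow a b c (- t) phi).
Proof.
move=> c0; have c0' : c^-1 != 0 by rewrite invr_eq0.
have [fx xphi] := line_solP a b phi c0.
have solrev : line_sol (- (b / c)) (- (a / c)) c^-1 (reverse phi) =
    (fun s => line_sol a b c phi (-1 - s)).
  by apply: line_solE => // [|theta]; [exact: full_sol_rev|rewrite revE -xphi].
apply: C10_ext => theta; rewrite revE !flowE// solrev.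
by congr line_sol; rewrite /=; ring.
Qed.

(** Reversing time exchanges the stable and the unstable projection. *)
Lemma splits_rev a b c P beta alpha : c != 0 -> splits a b c P beta alpha ->
  splits (- (b / c)) (- (a / c)) c^-1 (fun phi => reverse (reverse phi - P (reverse phi)))
    (- alpha) (- beta).
Proof.
move=> c0 [ba lP cP [K K0 bP]]; split.
- by rewrite ltrN2.
- move=> k phi psi; rewrite rev_lin lP -[RHS]rev_lin; congr reverse.
  by rewrite scalerBr opprD addrACA.
- move=> t phi; have E := flow_rev a b t (reverse phi) c0; rewrite revK in E.
  by rewrite flow_rev// E revK flowB// cP.
- exists K => // t phi t0; have [b1 b2] := bP t (reverse phi) t0.
  rewrite norm_rev in b1 b2; split.
    have -> : phi - reverse (reverse phi - P (reverse phi)) = reverse (P (reverse phi)).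
      by rewrite revB revK opprB addrC subrK.
    by rewrite flow_rev// norm_rev.
  by rewrite flow_rev// opprK norm_rev opprK.
Qed.

End reversal.

Section uniform_bound.
Variable R : realType.
Implicit Types (a b c M : R) (P : nat -> C10 R -> C10 R) (beta alpha : nat -> R).

(** The gaps are disjoint, so at most one contains [sigma] and infinitely many lie
    on one side of it; reversal of time changes the side. *)
Theorem splits_not_uniformly_bounded a b c P beta alpha M : c != 0 -> 0 <= M ->
  (forall m, splits a b c (P m) (beta m) (alpha m)) -> injective P ->
  (forall m phi, `|P m phi| <= M * `|phi|) -> False.
Proof.
move=> c0 M0 sP P_inj PM.
pose G1 := [set m | sigma c <= beta m]; pose G2 := [set m | alpha m <= sigma c].
have [fin1|inf1] := pselect (finite_set G1); last first.
  exact: (right_gaps_absurd c0 M0 sP P_inj PM inf1).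
have [fin2|inf2] := pselect (finite_set G2); last first.
  have c0' : c^-1 != 0 by rewrite invr_eq0.
  have M1 : 0 <= 1 + M by rewrite addr_ge0.
  apply: (@right_gaps_absurd _ _ _ _ (fun m phi => reverse (reverse phi - P m (reverse phi)))
    (fun m => - alpha m) (fun m => - beta m) (1 + M) c0' M1 _ _ _ G2 inf2).
  - by move=> m; exact: splits_rev.
  - move=> m k /(congr1 (fun f => fun phi => reverse (f (reverse phi)))) E; apply: P_inj.
    apply/funext => phi; have /(congr1 (fun f => f phi)) := E.
    by rewrite !revK => /addrI /oppr_inj.
  - move=> m phi; rewrite norm_rev (le_trans (ler_normB _ _))// mulrDl mul1r.
    by rewrite norm_rev lerD2l -(norm_rev phi) PM.
  - by move=> m /= al; rewrite /sigma normfV lnV ?posrE ?normr_gt0// lerN2.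
pose G3 := [set m | beta m < sigma c /\ sigma c < alpha m].
have fin3 : finite_set G3.
  have [[m [bm am]]|none] := pselect (exists m, G3 m); last first.
    suff -> : G3 = set0 by exact: finite_set0.
    by apply/seteqP; split=> // m Gm; apply: none; exists m.
  apply: (sub_finite_set _ (finite_set1 m)) => k [bk ak] /=; apply: P_inj.
  by apply: (splits_overlap c0 (sP k) (sP m)); lra.
apply: infinite_nat; apply: (sub_finite_set _ (_ : finite_set (G1 `|` G2 `|` G3))).
  move=> m _; have [h1|h1] := leP (sigma c) (beta m); first by left; left.
  by have [h2|h2] := leP (alpha m) (sigma c); [left; right|right].
by rewrite !finite_setU.
Qed.

End uniform_bound.

(** * Exponential dichotomies *)

Section dichotomies.
Variable R : realType.
Implicit Types (a b c k M : R).

Lemma opnorm_bound (A : C10 R -> C10 R) k :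
  (forall r phi, A (r *: phi) = r *: A phi) -> (opnorm A <= k%:E)%E ->
  forall phi, `|A phi| <= k * `|phi|.
Proof.
move=> hA Ak phi; have [->|phi0] := eqVneq phi 0.
  have -> : A 0 = 0 by rewrite -[in LHS](scale0r 0) hA scale0r.
  by rewrite !normr0 mulr0.
have np : 0 < `|phi| by rewrite normr_gt0.
have : (`|A (`|phi|^-1 *: phi)|%:E <= k%:E)%E.
  apply: le_trans Ak; apply: ereal_sup_ubound; exists (`|phi|^-1 *: phi) => //=.
  by rewrite normrZ normfV normr_id mulVf// gt_eqF.
by rewrite lee_fin hA normrZ normfV normr_id ler_pdivrMl// mulrC.
Qed.

Lemma linear_scale (A : C10 R -> C10 R) : linear A ->
  forall r phi, A (r *: phi) = r *: A phi.
Proof.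
move=> lA r phi; have A0 : A 0 = 0.
  by have := lA (-1) 0 0; rewrite scaler0 addr0 scaleN1r addNr.
by rewrite -[r *: phi]addr0 lA A0 addr0.
Qed.

Lemma flow_scale a b c t r (phi : C10 R) : c != 0 ->
  flow a b c t (r *: phi) = r *: flow a b c t phi.
Proof. by move=> c0; apply: linear_scale => k u v; exact: flow_lin. Qed.

Lemma dichotomy_splits a b c Pp Pm beta alpha K : c != 0 ->
  exp_dichotomy (solution_operator a b c) Pp Pm beta alpha K ->
  splits a b c Pp beta alpha.
Proof.
move=> c0 [[[lm _ _] [lp _ _] PpE] [ba K1] com [Tinv TinvP]].
have SE t phi : 0 <= t -> solution_operator a b c t phi = flow a b c t phi.
  by move=> t0; exact: solution_operatorE.
have comP t phi : 0 <= t -> flow a b c t (Pp phi) = Pp (flow a b c t phi).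
  move=> t0; have [_ /(congr1 (@^~ phi))] := com t t0.
  by rewrite /= !SE.
split=> //.
  move=> t phi; have [t0|/ltW t0] := leP 0 t; first exact: comP.
  have nt0 : 0 <= - t by rewrite oppr_ge0.
  have := comP (- t) (flow a b c t phi) nt0; rewrite flowKN// => <-.
  by rewrite flowNK.
exists K; first by rewrite (le_trans ler01).
move=> t phi t0; have [iso b1 b2] := TinvP t t0.
have PmE : phi - Pp phi = Pm phi by rewrite PpE subKr.
split.
  rewrite PmE -SE//; apply: (opnorm_bound _ b1) => r psi /=.
  by rewrite !SE// (linear_scale lm) flow_scale.
have TE psi : Tinv t (Pp psi) = flow a b c (- t) (Pp psi).
  have [_ _ H _ _] := iso; have [] := H (Pp psi); first by exists psi.
  by move=> _ E; rewrite -[in RHS]E SE// flowKN.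
rewrite -TE; apply: (opnorm_bound _ b2) => r psi /=.
by rewrite !TE (linear_scale lp) flow_scale.
Qed.

Lemma ereal_sup_infty (u : nat -> \bar R) :
  (forall M, 0 <= M -> ~ forall m, (u m <= M%:E)%E) ->
  ereal_sup [set u m | m in [set: nat]] = +oo%E.
Proof.
move=> H; set S := ereal_sup _.
have uS m : (u m <= S)%E by apply: ereal_sup_ubound; exists m.
case: S uS => [r| |] // uS; exfalso.
  apply: (H `|r|) => // m; apply: (le_trans (uS m)).
  by rewrite lee_fin ler_norm.
by apply: (H 0) => // m; apply: (le_trans (uS m)); exact: leNye.
Qed.

End dichotomies.

Theorem theorem1p2 (R : realType) (a b c : R)
    (c_neq0 : c != 0)
    (a_neq : a != b / `|c|)
    (lnc_neq : ln `|c| != - (1 / 2) * (a + b / `|c|))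
    (Pp Pm : nat -> C10 R -> C10 R) (beta alpha K : nat -> R)
    (dichotomies :
      lists_dichotomies (solution_operator a b c) Pp Pm beta alpha K) :
  (ereal_sup [set opnorm (Pp m) | m in [set: nat]] = +oo%E /\
   ereal_sup [set opnorm (Pm m) | m in [set: nat]] = +oo%E) /\
  ereal_sup [set (K m)%:E | m in [set: nat]] = +oo%E.
Proof.
have [dich uniq_dich] := dichotomies.
have sP m := dichotomy_splits c_neq0 (dich m).
have PpE m phi : Pp m phi = phi - Pm m phi.
  by have [[_ _ E] _ _ _] := dich m; rewrite {1}E.
have lin m : linear (Pp m) /\ linear (Pm m).
  by have [[[lm _ _] [lp _ _] _] _ _ _] := dich m.
have P_inj : injective Pp.
  move=> m k mk; have [n [_ nE]] := uniq_dich _ _ _ _ _ (dich m).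
  have Pmk : Pm m = Pm k.
    apply/funext => phi; have := PpE m phi; rewrite mk PpE.
    by move=> /addrI /oppr_inj.
  by rewrite -(nE m)// -(nE k)// mk Pmk.
have absurd M : 0 <= M -> (forall m phi, `|Pp m phi| <= M * `|phi|) -> False.
  by move=> M0; exact: splits_not_uniformly_bounded c_neq0 M0 sP P_inj.
have absurdN M : 0 <= M -> (forall m phi, `|Pm m phi| <= M * `|phi|) -> False.
  move=> M0 H; apply: (absurd (1 + M)); first by rewrite addr_ge0.
  by move=> m phi; rewrite PpE (le_trans (ler_normB _ _))// mulrDl mul1r lerD2l.
split; first split; apply: ereal_sup_infty => M M0 H.
- apply: (absurd M M0) => m; apply: opnorm_bound (H m).
  by apply: linear_scale; have [] := lin m.
- apply: (absurdN M M0) => m; apply: opnorm_bound (H m).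
  by apply: linear_scale; have [] := lin m.
- apply: (absurdN M M0) => m phi.
  have [_ _ _ [Tinv TP]] := dich m.
  have [_ b1 _] := TP 0 (lexx 0).
  have T0 psi : solution_operator a b c 0 psi = psi.
    by rewrite solution_operatorE// flow0.
  have : (opnorm (Pm m) <= M%:E)%E.
    apply: le_trans (H m); move: b1; rewrite mulr0 expR0 mulr1.
    by have -> : solution_operator a b c 0 \o Pm m = Pm m by apply/funext => psi /=.
  by move=> /opnorm_bound; apply; apply: linear_scale; have [] := lin m.
Qed.
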